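(* Let $X\sim \mathrm{mPH}(\boldsymbol{\pi},\mathcal{T})$ with $\mathcal{T}=\{\boldsymbol{T}_1,\dots,\boldsymbol{T}_d\}$. Then for $k,l\in\{1,\dots,d\}$ with $k\neq l$, the Spearman correlation of $X_k$ and $X_l$ is $$\rho^S_{X_k,X_l}=12\sum_{j=1}^p\pi_j\left(1+(\boldsymbol{\pi}\otimes\boldsymbol{e}_j^{\mathsf{T}})[\boldsymbol{T}_k\oplus\boldsymbol{T}_k]^{-1}(\boldsymbol{e}\otimes\boldsymbol{t}_k)\right)\left(1+(\boldsymbol{\pi}\otimes\boldsymbol{e}_j^{\mathsf{T}})[\boldsymbol{T}_l\oplus\boldsymbol{T}_l]^{-1}(\boldsymbol{e}\otimes\boldsymbol{t}_l)\right)-3.$$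
   Context: Notation: $\otimes$ and $\oplus$ denote the Kronecker product and Kronecker sum of matrices ($A\oplus B=A\otimes I+I\otimes B$); $\boldsymbol{e}_j$ is the $j$-th canonical basis (column) vector of $\mathbb{R}^p$ and $\boldsymbol{e}=\sum_{j=1}^p\boldsymbol{e}_j$. Spearman correlation: for i.i.d. random vectors $(X_1,X_2)$, $(Y_1,Y_2)$, $(Z_1,Z_2)$, $\rho^S_{X_1,X_2}=3\left[\mathbb{P}((X_1-Z_1)(X_2-Y_2)>0)-\mathbb{P}((X_1-Z_1)(X_2-Y_2)<0)\right]$. mPH class. Let $\boldsymbol{\pi}=(\pi_1,\dots,\pi_p)$ be a probability row vector and let $\boldsymbol{T}_1,\dots,\boldsymbol{T}_d$ be real $p\times p$ sub-intensity matrices (nonnegative off-diagonal entries, strictly negative diagonal entries, nonpositive row sums) for which all states $1,\dots,p$ are transient (equivalently, each $\boldsymbol{T}_i$ is invertible). Let $\boldsymbol{t}_i=-\boldsymbol{T}_i\boldsymbol{e}$. For $i=1,\dots,d$ let $(J^{(i)}_t)_{t\ge 0}$ be a time-homogeneous Markov jump process on $\{1,\dots,p,p+1\}$ with $p+1$ absorbing, with transition intensities between the states $1,\dots,p$ given by $\boldsymbol{T}_i$ and intensities of jumping to $p+1$ given by $\boldsymbol{t}_i$. Assume that all the processes start in the same state, $J_0^{(1)}=\dots=J_0^{(d)}=:J_0$ with $\mathbb{P}(J_0=j)=\pi_j$ for $j=1,\dots,p$, and that the $d$ processes are conditionally independent given $J_0$. Put $X_i=\inf\{t>0: J^{(i)}_t=p+1\}$.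 Then $X=(X_1,\dots,X_d)$ is said to be mPH (multivariate phase-type) distributed, written $X\sim \mathrm{mPH}(\boldsymbol{\pi},\mathcal{T})$ with $\mathcal{T}=\{\boldsymbol{T}_1,\dots,\boldsymbol{T}_d\}$ (indexed by $i=1,\dots,d$). *)

(* Defs.v *)
From HB Require Import structures.
From mathcomp Require Import all_boot all_order all_algebra.
From mathcomp Require Import all_classical all_reals all_analysis.
From mathcomp Require Import measurable_realfun mxtens.

Set Implicit Arguments.
Unset Strict Implicit.
Unset Printing Implicit Defensive.

Import Order.TTheory GRing.Theory Num.Theory.
Import numFieldNormedType.Exports.

Local Open Scope classical_set_scope.
Local Open Scope ring_scope.

(* [A *t B] is the Kronecker product of real_closed.mxtens. *)
Definition kronsum (R : pzRingType) (p q : nat) (A : 'M[R]_p) (B : 'M[R]_q) :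
  'M[R]_(p * q) := A *t 1%:M + 1%:M *t B.

Definition basis_col (R : pzRingType) (p : nat) (j : 'I_p) : 'cV[R]_p :=
  delta_mx j 0.

Definition ones_col (R : pzRingType) (p : nat) : 'cV[R]_p :=
  \sum_(j < p) basis_col R j.
Arguments ones_col R p : clear implicits.

Definition exit_rates (R : pzRingType) (p : nat) (T : 'M[R]_p) : 'cV[R]_p :=
  - (T *m ones_col R p).

Definition probability_row (R : numDomainType) (p : nat) (pi : 'rV[R]_p) :=
  (forall j, 0 <= pi 0 j) /\ \sum_j pi 0 j = 1.

(* The last clause says that all states 1, ..., p are transient. *)
Definition transient_subintensity (R : realFieldType) (p : nat)
    (T : 'M[R]_p) :=
  [/\ forall i j, i != j -> 0 <= T i j,
      forall i, T i i < 0,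
      forall i, \sum_j T i j <= 0
    & T \in unitmx].

(* The state space {1, ..., p, p+1} is ['I_(p + 1)]: the transient states are
   [lshift 1 j] and the absorbing one is [absorbing p]. *)
Definition absorbing (p : nat) : 'I_(p + 1) := rshift p ord0.

Definition full_intensity (R : pzRingType) (p : nat) (T : 'M[R]_p) :
  'M[R]_(p + 1) := block_mx T (exit_rates T) 0 0.

Section Processes.
Context {d : measure_display} {Omega : measurableType d} {R : realType}.
Variable P : probability Omega R.

(* Only used when P B > 0. *)
Definition cond_prob (A B : set Omega) : R := fine (P (A `&` B)) / fine (P B).

Definition transition_semigroup (n : nat) (Q : 'M[R]_n) (p : R -> 'M[R]_n) :=
  [/\ forall t, 0 <= t ->
        (forall x y, 0 <= p t x y) /\ (forall x, \sum_y p t x y = 1),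
      p 0 = 1%:M,
      forall s t, 0 <= s -> 0 <= t -> p (s + t) = p s *m p t
    & forall x y, (p h x y - (x == y)%:R) / h @[h --> 0^'+] --> Q x y].

(* [hist] is a finite list of pairs (time, state). *)
Definition history (n : nat) (J : R -> Omega -> 'I_n) (hist : seq (R * 'I_n)) :
  set Omega := [set w | forall u, u \in hist -> J u.1 w = u.2].

(* Processes are indexed by the reals; only the times t >= 0 matter. *)
Definition markov_jump_process (n : nat) (Q : 'M[R]_n)
    (J : R -> Omega -> 'I_n) :=
  [/\ forall t x, 0 <= t -> measurable (J t @^-1` [set x]),
      forall w t, 0 <= t -> \forall s \near t^'+, J s w = J t w,
      forall w t, 0 < t -> exists x, \forall s \near t^'-, J s w = x
    & exists2 p, transition_semigroup Q p &
      forall s t (x y : 'I_n) (hist : seq (R * 'I_n)),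
        0 <= s -> 0 <= t -> (forall u, u \in hist -> 0 <= u.1 <= s) ->
        (0 < P (J s @^-1` [set x] `&` history J hist))%E ->
        cond_prob (J (s + t) @^-1` [set y])
                  (J s @^-1` [set x] `&` history J hist) = p t x y].

Definition sigma_process (n : nat) (J : R -> Omega -> 'I_n) :
  set (set Omega) :=
  <<s [set A | exists t x, 0 <= t /\ A = J t @^-1` [set x]] >>.

(* Events [A i] equal to [setT] are allowed, so the product rule over all
   indices covers every subfamily. *)
Definition cond_independent_processes (m n : nat)
    (J : 'I_m -> R -> Omega -> 'I_n) (J0 : Omega -> 'I_n) :=
  forall x, (0 < P (J0 @^-1` [set x]))%E ->
  forall A : 'I_m -> set Omega, (forall i, sigma_process (J i) (A i)) ->
    cond_prob (\bigcap_(i in [set: 'I_m]) A i) (J0 @^-1` [set x])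
    = \prod_(i < m) cond_prob (A i) (J0 @^-1` [set x]).

Definition absorption_time (p : nat) (J : R -> Omega -> 'I_(p + 1))
    (w : Omega) : \bar R :=
  ereal_inf [set t%:E | t in [set t | 0 < t /\ J t w = absorbing p]].

(* Absorption times are finite only almost surely, whence the a.e. clause
   for the real-valued random variables [X i]. *)
Definition mPH (m p : nat) (pi : 'rV[R]_p) (T : 'I_m -> 'M[R]_p)
    (X : 'I_m -> {RV P >-> R}) :=
  [/\ probability_row pi,
      forall i, transient_subintensity (T i)
    & exists (J0 : Omega -> 'I_(p + 1)) (J : 'I_m -> R -> Omega -> 'I_(p + 1)),
      [/\ forall i, markov_jump_process (full_intensity (T i)) (J i),
          forall i w, J i 0 w = J0 w,
          forall j, P (J0 @^-1` [set lshift 1 j]) = (pi 0 j)%:E,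
          cond_independent_processes J J0
        & forall i, {ae P, forall w, (X i w)%:E = absorption_time (J i) w}]].

(* The i.i.d. copies of (X1, X2) are its values at the three independent
   coordinates of Omega^3; by [spearmanE] below any other i.i.d. copies
   yield the same value. *)
Definition spearman (X1 X2 : {RV P >-> R}) : R :=
  let P3 := ((P \x P) \x P)%E in
  let D (w : Omega * Omega * Omega) :=
    (X1 w.1.1 - X1 w.2) * (X2 w.1.1 - X2 w.1.2) in
  3 * (fine (P3 [set w | 0 < D w]) - fine (P3 [set w | D w < 0])).

End Processes.

Lemma eq_measure_rect d1 d2 (T1 : measurableType d1) (T2 : measurableType d2)
    (R : realType) (m m' : {measure set (T1 * T2) -> \bar R}) :
  (m setT < +oo)%E ->
  (forall A B, measurable A -> measurable B -> m (A `*` B) = m' (A `*` B)) ->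
  forall D, measurable D -> m D = m' D.
Proof.
move=> moo mm' D mD.
pose C : set (set (T1 * T2)) :=
  [set C | exists A, measurable A /\ exists B, measurable B /\ C = A `*` B].
apply: (measure_unique C (fun=> setT)) => //.
- rewrite measurable_prod_measurableType //; congr (<<s _ >>).
  rewrite predeqE; split => [[A mA [B mB <-]]|[A [mA [B [mB ->]]]]].
    by exists A; split => //; exists B.
  by exists A => //; exists B.
- move=> /= _ _ [X1 [mX1 [X2 [mX2 ->]]]] [Y1 [mY1 [Y2 [mY2 ->]]]].
  rewrite -setXI; exists (X1 `&` Y1); split; first exact: measurableI.
  by exists (X2 `&` Y2); split => //; exact: measurableI.
- by move=> _; exists setT; split => //; exists setT; split=> //; rewrite setXTT.
- by rewrite bigcup_const.
- by move=> A [A1 [mA1 [A2 [mA2 ->]]]]; exact: mm'.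
Qed.

Definition push_measure d1 d2 (T1 : measurableType d1) (T2 : measurableType d2)
    (R : realType) (m : {measure set T1 -> \bar R}) (f : T1 -> T2)
    (mf : measurable_fun [set: T1] f) : {measure set T2 -> \bar R} :=
  measure_function_pushforward__canonical__measure_function_Measure m mf.

Lemma eq_measure_rect3 d0 (V : measurableType d0) (R : realType)
    (m m' : {measure set (V * V * V) -> \bar R}) :
  (m setT < +oo)%E ->
  (forall A B C, measurable A -> measurable B -> measurable C ->
    m (A `*` B `*` C) = m' (A `*` B `*` C)) ->
  forall D, measurable D -> m D = m' D.
Proof.
move=> moo mm'; apply: eq_measure_rect => // A C mA mC.
have mTC : measurable ([set: V * V] `*` C) by exact: measurableX.
have mfst : measurable_fun [set: V * V * V] fst by exact: measurable_fst.
pose n := push_measure (mrestr m mTC) mfst.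
pose n' := push_measure (mrestr m' mTC) mfst.
have E (mu : set (V * V * V) -> \bar R) (B : set (V * V)) :
    mu (fst @^-1` B `&` ([set: V * V] `*` C)) = mu (B `*` C).
  by congr mu; apply/seteqP; split => -[x y] /=; tauto.
have /(_ A mA) : forall B, measurable B -> n B = n' B.
  apply: eq_measure_rect => [|B B' mB mB'].
    rewrite /n /= /pushforward /mrestr E; apply: le_lt_trans moo.
    by apply: le_measure; rewrite ?inE //; exact: measurableX.
  by rewrite /n /n' /= /pushforward /mrestr !E; exact: mm'.
by rewrite /n /n' /= /pushforward /mrestr !E.
Qed.

(* For every i.i.d. triple U = (X_1, X_2), V = (Y_1, Y_2), W = (Z_1, Z_2) with
   the law of (X1, X2), [spearman] is the textbook expression. *)
Lemma spearmanE (R : realType) d (Omega : measurableType d)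
    (P : probability Omega R) (X1 X2 : {RV P >-> R})
    d' (Omega' : measurableType d') (Q : probability Omega' R)
    (U V W : {RV Q >-> (R * R)%type}) :
  (forall (Y : {RV Q >-> (R * R)%type}), Y = U \/ Y = V \/ Y = W ->
    forall A, measurable A ->
      Q (Y @^-1` A) = P ((fun w => (X1 w, X2 w)) @^-1` A)) ->
  (forall A B C, measurable A -> measurable B -> measurable C ->
    Q (U @^-1` A `&` V @^-1` B `&` W @^-1` C) =
    (Q (U @^-1` A) * Q (V @^-1` B) * Q (W @^-1` C))%E) ->
  spearman X1 X2 =
  3 * (fine (Q [set w | 0 < ((U w).1 - (W w).1) * ((U w).2 - (V w).2)])
     - fine (Q [set w | ((U w).1 - (W w).1) * ((U w).2 - (V w).2) < 0])).
Proof.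
move=> id_UVW indep.
pose X w := (X1 w, X2 w).
have mX : measurable_fun [set: Omega] X by exact: measurable_fun_pair.
pose f (w : Omega * Omega * Omega) := (X w.1.1, X w.1.2, X w.2).
pose g w := (U w, V w, W w).
have mf : measurable_fun [set: Omega * Omega * Omega] f.
  apply: measurable_fun_pair; first apply: measurable_fun_pair.
  - apply: (measurableT_comp mX); exact: measurableT_comp.
  - apply: (measurableT_comp mX); exact: measurableT_comp.
  - exact: (measurableT_comp mX).
have mg : measurable_fun [set: Omega'] g.
  by apply: measurable_fun_pair => //; exact: measurable_fun_pair.
pose P3 : {measure set (Omega * Omega * Omega) -> \bar R} :=
  ((P \x P) \x P)%E.
have P3E A B C : measurable A -> measurable B -> measurable C ->
    P3 (A `*` B `*` C) = (P A * P B * P C)%E.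
  move=> mA mB mC; rewrite /P3 /= product_measure1E //; last exact: measurableX.
  by congr (_ * _)%E; exact: product_measure1E.
have mpre A : measurable A -> measurable (X @^-1` A).
  by move=> mA; rewrite -[X in measurable X]setTI; exact: mX.
have eqP3Q D : measurable D -> P3 (f @^-1` D) = Q (g @^-1` D).
  apply: (@eq_measure_rect3 _ _ _ (push_measure P3 mf) (push_measure Q mg)).
    rewrite /= /pushforward preimage_setT -setXTT -setXTT P3E //.
    by rewrite !probability_setT !mule1 ltry.
  move=> A B C mA mB mC.
  rewrite /= /pushforward.
  rewrite [f @^-1` _](_ : _ = X @^-1` A `*` X @^-1` B `*` X @^-1` C) //.
  rewrite [g @^-1` _](_ : _ = U @^-1` A `&` V @^-1` B `&` W @^-1` C) //.
  rewrite P3E ?indep //; try exact: mpre.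
  by rewrite !id_UVW //; tauto.
pose h (v : R * R * (R * R) * (R * R)) := (v.1.1.1 - v.2.1) * (v.1.1.2 - v.1.2.2).
have mh : measurable_fun setT h.
  apply: measurable_funM; apply: measurable_funB;
    by repeat (apply: measurableT_comp => //).
have mpos : measurable [set v | 0 < h v].
  rewrite [X in measurable X](_ : _ = h @^-1` `]0, +oo[); last first.
    by apply/seteqP; split => v /=; rewrite in_itv /= andbT.
  by rewrite -[X in measurable X]setTI; exact: mh.
have mneg : measurable [set v | h v < 0].
  rewrite [X in measurable X](_ : _ = h @^-1` `]-oo, 0[); last first.
    by apply/seteqP; split => v /=; rewrite in_itv /=.
  by rewrite -[X in measurable X]setTI; exact: mh.
by rewrite /spearman; congr (_ * (fine _ - fine _)); [exact: eqP3Q mpos|exact: eqP3Q mneg].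
Qed.

(* Main.v *)
Require Import Defs.
From HB Require Import structures.
From mathcomp Require Import all_boot all_order all_algebra.
From mathcomp Require Import all_classical all_reals all_analysis.
From mathcomp Require Import measurable_realfun mxtens ring lra.

Import Order.TTheory GRing.Theory Num.Theory.
Import numFieldNormedType.Exports.

Local Open Scope classical_set_scope.
Local Open Scope ring_scope.

(** Write [F_i] for the distribution function of [X_i] and [B_{ij} = P(Z_i > X_i | J_0 = j)]
for an independent copy [Z_i] of [X_i]. There are no ties, and [X_k], [X_l] are independent
given [J_0], so splitting according to the signs of [X_1 - Z_1] and [X_2 - Y_2] gives
[rho = 3 sum_j pi_j (1 - 2 B_{kj}) (1 - 2 B_{lj})]; as [sum_j pi_j B_{ij} = 1/2], this is
[12 sum_j pi_j (1 - B_{kj}) (1 - B_{lj}) - 3].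

It remains to compute [B_{ij} = sum_a pi_a M_{aj}], where [M_{aj}] is the probability that an
absorption time started in [a] exceeds an independent one started in [j]. Running both
processes up to time [h], with [U(h)] the transition matrix of the transient states, gives
[M = r(h) + U(h) M U(h)^T] where [r(h)_{aj} = h t_j + o(h)]; letting [h] tend to [0] yields
[T M + M T^T = - e t^T], i.e. [(T (+) T) vec M = - e (x) t]. The Kronecker sum is invertible:
[y = - T^{-1} e] is positive and [(T (+) T) (y (x) y) < 0], which is a weighted strict
diagonal dominance. *)

Set Implicit Arguments.
Unset Strict Implicit.
Unset Printing Implicit Defensive.

(** * Lyapunov equations and Kronecker sums *)

Lemma unitmx_ker0 (F : fieldType) n (K : 'M[F]_n) :
  (forall w : 'cV_n, K *m w = 0 -> w = 0) -> K \in unitmx.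
Proof.
move=> K0; rewrite -unitmx_tr -row_free_unit -kermx_eq0.
apply/eqP/row_matrixP => i; rewrite row0; apply: trmx_inj; rewrite trmx0.
apply: K0; apply: trmx_inj; rewrite trmx_mul trmxK trmx0.
by rewrite -row_mul mulmx_ker row0.
Qed.

Lemma arg_max_ord (R : realFieldType) n (f : 'I_n -> R) (i0 : 'I_n) :
  exists i, forall j, f j <= f i.
Proof.
by case: (@Order.TotalTheory.arg_maxP _ _ _ i0 xpredT f erefl) => i _ h;
  exists i => j; exact: h.
Qed.

(* Weighted diagonal dominance: look at an entry maximizing [w / y]. *)
Lemma metzler_unitmx (R : realFieldType) n (K : 'M[R]_n) (y : 'cV[R]_n) :
  (forall a b, a != b -> 0 <= K a b) ->
  (forall a, 0 < y a 0) -> (forall a, (K *m y) a 0 < 0) -> K \in unitmx.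
Proof.
move=> K0 y0 Ky.
suff H (w : 'cV_n) : K *m w = 0 -> forall a, w a 0 <= 0.
  apply: unitmx_ker0 => w Kw; apply/matrixP => a b; rewrite mxE ord1.
  apply/eqP; rewrite eq_le H //= -oppr_le0.
  by have := H (- w); rewrite mulmxN Kw oppr0 => /(_ erefl a); rewrite mxE.
move=> Kw a.
have [b hb] := arg_max_ord (fun a => w a 0 / y a 0) a.
suff wb : w b 0 / y b 0 <= 0.
  by have := le_trans (hb a) wb; rewrite pmulr_lle0 // invr_gt0.
rewrite leNgt; apply/negP => m0; set m := w b 0 / y b 0 in hb m0.
(* By maximality [w c 0 <= m * y c 0] for all [c], with equality at [c = b]; a strict inequality is
   thus only ever multiplied by a nonnegative off-diagonal entry of [K]. *)
have : (K *m w) b 0 <= m * (K *m y) b 0.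
  rewrite !mxE mulr_sumr; apply: ler_sum => c _; rewrite mulrCA.
  have [<-|nbc] := eqVneq b c; first by rewrite /m divfK // gt_eqF.
  by rewrite ler_wpM2l ?K0 // -ler_pdivrMr ?hb.
by rewrite Kw mxE leNgt pmulr_rlt0 // Ky.
Qed.

Lemma ones_colE (R : pzRingType) p i j : ones_col R p i j = 1.
Proof.
rewrite /ones_col summxE (bigD1 i) //= big1 ?addr0 => [|k ki].
  by rewrite mxE eqxx ord1.
by rewrite mxE eq_sym (negbTE ki).
Qed.

Lemma exit_ratesE (R : pzRingType) p (T : 'M[R]_p) i j :
  exit_rates T i j = - \sum_k T i k.
Proof.
rewrite /exit_rates !mxE; congr (- _); apply: eq_bigr => k _.
by rewrite ones_colE mulr1.
Qed.

(** The vector [y] holds the expected absorption times. Positivity is a minimum principle: a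
    negative minimal entry at [k] would make [(T y)_k] at least [y_k] times a row sum, hence
    nonnegative, against [-1]. A zero entry leaves only nonnegative off-diagonal terms, with the
    same contradiction. *)
Lemma transient_potential (R : realFieldType) p (T : 'M[R]_p) :
  transient_subintensity T ->
  exists2 y : 'cV[R]_p, forall i, 0 < y i 0 & T *m y = - ones_col R p.
Proof.
move=> [T0 Td Ts uT]; exists (invmx T *m - ones_col R p); last by rewrite mulKVmx.
set y := invmx T *m _.
have Ty i : \sum_j T i j * y j 0 = -1.
  have : (T *m y) i 0 = -1 by rewrite mulKVmx // mxE ones_colE.
  by rewrite mxE.
have y0 i : 0 <= y i 0.
  have [k hk] := arg_max_ord (fun j => - y j 0) i.
  suff yk : 0 <= y k 0 by rewrite -oppr_le0; apply: le_trans (hk i) _; rewrite oppr_le0.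
  rewrite leNgt; apply/negP => yk.
  have : y k 0 * (\sum_j T k j) <= -1.
    rewrite -(Ty k) mulr_sumr; apply: ler_sum => j _; rewrite mulrC.
    have [->//|nkj] := eqVneq k j.
    by rewrite ler_wpM2l ?T0 // -lerN2.
  apply/negP; rewrite -ltNge; apply: (@lt_le_trans _ _ 0); first by rewrite ltrN10.
  by apply: mulr_le0 => //; exact: ltW.
move=> i; rewrite lt_neqAle y0 andbT eq_sym; apply/eqP => yi.
have : 0 <= \sum_j T i j * y j 0.
  rewrite sumr_ge0 // => j _.
  by have [<-|nij] := eqVneq i j; rewrite ?yi ?mulr0 // mulr_ge0 ?T0.
by rewrite Ty oppr_ge0 ler10.
Qed.

Lemma sum_mxtens (R : nmodType) m n (F : 'I_(m * n) -> R) :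
  \sum_k F k = \sum_i \sum_j F (mxtens_index (i, j)).
Proof.
rewrite pair_big /= (reindex (@mxtens_index m n)) /=; last first.
  by exists (@mxtens_unindex m n) => k _; rewrite ?mxtens_indexK ?mxtens_unindexK.
by apply: eq_bigr => -[].
Qed.

Lemma kronsumE (R : pzRingType) p q (A : 'M[R]_p) (B : 'M[R]_q) i j i' j' :
  kronsum A B (mxtens_index (i, j)) (mxtens_index (i', j')) =
  A i i' * (j == j')%:R + (i == i')%:R * B j j'.
Proof. by rewrite /kronsum mxE !tensmxE !mxE. Qed.

(** Row-by-row vectorization, in the index order of [*t], so that [A *t B] acts as
    [M -> A M B^T]. *)
Definition vec_tens (R : pzRingType) p q (M : 'M[R]_(p, q)) : 'cV[R]_(p * q) :=
  \col_k M (mxtens_unindex k).1 (mxtens_unindex k).2.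

Lemma vec_tensE (R : pzRingType) p q (M : 'M[R]_(p, q)) i j :
  vec_tens M (mxtens_index (i, j)) 0 = M i j.
Proof. by rewrite mxE mxtens_indexK. Qed.

Lemma kronsum_vec (R : comPzRingType) p (A B M : 'M[R]_p) :
  kronsum A B *m vec_tens M = vec_tens (A *m M + M *m B^T).
Proof.
apply/colP => k; case: (mxtens_indexP k) => i j; rewrite vec_tensE !mxE sum_mxtens.
under eq_bigr => i' _ do under eq_bigr => j' _ do
  rewrite kronsumE vec_tensE mulrDl.
under eq_bigr => i' _ do rewrite big_split /=.
rewrite big_split /=; congr (_ + _).
  apply: eq_bigr => i' _; rewrite (bigD1 j) //= eqxx mulr1 big1 ?addr0 // => j' nj.
  by rewrite eq_sym (negbTE nj) mulr0 mul0r.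
rewrite exchange_big /=; apply: eq_bigr => j' _.
rewrite (bigD1 i) //= eqxx mul1r big1 ?addr0 => [|i' ni]; first by rewrite mxE mulrC.
by rewrite eq_sym (negbTE ni) !mul0r.
Qed.

(** Diagonal dominance with the weight [y y^T]: since [T y = - e], its image is [- (e y^T + y e^T)],
    all of whose entries are negative. *)
Lemma kronsum_unitmx (R : realFieldType) p (T : 'M[R]_p) :
  transient_subintensity T -> kronsum T T \in unitmx.
Proof.
move=> tT; have [y y0 Ty] := transient_potential tT; have [T0 _ _ _] := tT.
apply: (@metzler_unitmx _ _ _ (vec_tens (y *m y^T))).
- move=> a b; case: (mxtens_indexP a) => i j; case: (mxtens_indexP b) => i' j'.
  rewrite (can_eq (@mxtens_indexK _ _)) xpair_eqE kronsumE.
  have [->|ni] := eqVneq i i'; have [->|nj] := eqVneq j j' => //= _.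
  + by rewrite mulr0 mul1r add0r T0.
  + by rewrite mul0r addr0 mulr1 T0.
  + by rewrite mulr0 mul0r addr0.
- move=> a; case: (mxtens_indexP a) => i j; rewrite vec_tensE mxE big_ord1 !mxE.
  by rewrite mulr_gt0 // y0.
- move=> a; case: (mxtens_indexP a) => i j; rewrite kronsum_vec vec_tensE.
  rewrite -mulmxA -trmx_mul mulmxA Ty mulNmx linearN /= mulmxN -opprD.
  rewrite !mxE !big_ord1 !mxE !ones_colE mul1r mulr1 oppr_lt0.
  by rewrite addr_gt0 // y0.
Qed.

Lemma tens_colE (R : pzRingType) p q (a : 'cV[R]_p) (b : 'cV[R]_q) i j z :
  (a *t b) (mxtens_index (i, j)) z = a i 0 * b j 0.
Proof. by case: (mxtens_indexP z) => z1 z2; rewrite tensmxE !ord1. Qed.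

Lemma tens_rowE (R : pzRingType) p q (a : 'rV[R]_p) (b : 'rV[R]_q) i j z :
  (a *t b) z (mxtens_index (i, j)) = a 0 i * b 0 j.
Proof. by case: (mxtens_indexP z) => z1 z2; rewrite tensmxE !ord1. Qed.

(** The right-hand side is the matrix [- e t^T]. The intended solution has as entry [(i, j)] the
    probability that absorption from [i] comes after an independent absorption from [j]. *)
Definition exit_lyapunov (R : pzRingType) p (T M : 'M[R]_p) :=
  forall i j, (T *m M + M *m T^T) i j = - exit_rates T j 0.

(** Vectorizing the equation exhibits [e (x) t] as the image of [vec (- M)] under the Kronecker sum.
    The inverse cancels, and the row vector picks the [a]-average of column [j]. *)
Lemma exit_lyapunov_kron (R : realFieldType) p (T M : 'M[R]_p) (a : 'rV[R]_p) j :
  transient_subintensity T -> exit_lyapunov T M ->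
  ((a *t (basis_col R j)^T) *m invmx (kronsum T T)
   *m (ones_col R p *t exit_rates T)) 0 0 = - \sum_i a 0 i * M i j.
Proof.
move=> tT TM; have uK := kronsum_unitmx tT.
have -> : ones_col R p *t exit_rates T = kronsum T T *m vec_tens (- M).
  apply/matrixP => k z; rewrite (ord1 z).
  case: (mxtens_indexP k) => i j'; rewrite kronsum_vec vec_tensE.
  by rewrite mulmxN mulNmx -opprD [RHS]mxE TM opprK tens_colE ones_colE mul1r.
rewrite -mulmxA mulKmx // mxE sum_mxtens -sumrN; apply: eq_bigr => i _.
rewrite (bigD1 j) //= big1 ?addr0 => [|j' nj].
  by rewrite vec_tensE tens_rowE !mxE !eqxx mulr1 mulrN.
by rewrite tens_rowE !mxE (negbTE nj) mulr0 mul0r.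
Qed.

Lemma vec_tens_inj (R : pzRingType) p q : injective (@vec_tens R p q).
Proof.
by move=> M N MN; apply/matrixP => i j; rewrite -[LHS]vec_tensE MN vec_tensE.
Qed.

(* [M + M^T] and the all-ones matrix solve the same Lyapunov equation. *)
Lemma exit_lyapunov_sym (R : realFieldType) p (T M : 'M[R]_p) i j :
  transient_subintensity T -> exit_lyapunov T M -> M i j + M j i = 1.
Proof.
move=> tT TM; have uK := kronsum_unitmx tT.
suff /matrixP/(_ i j) : M + M^T = const_mx 1 by rewrite !mxE.
apply: vec_tens_inj; apply: (can_inj (mulKmx uK)); rewrite !kronsum_vec.
congr vec_tens; apply/matrixP => a b.
have -> : T *m (M + M^T) + (M + M^T) *m T^T =
    (T *m M + M *m T^T) + (T *m M + M *m T^T)^T.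
  rewrite (linearD (@trmx R p p)) /= !trmx_mul trmxK mulmxDr mulmxDl.
  by rewrite -!addrA; congr (_ + _); rewrite addrCA; congr (_ + _); rewrite addrC.
(* For the all-ones matrix the entry is the sum of the row sums of [T] at [a] and [b], that is,
   minus both exit rates. *)
rewrite [LHS]mxE TM [X in _ + X = _]mxE TM !exit_ratesE !opprK [RHS]mxE !mxE addrC.
by congr (_ + _); apply: eq_bigr => c _; rewrite !mxE ?mulr1 ?mul1r.
Qed.

(** * Transition semigroups with an absorbing state *)

Lemma cvg_of_quotient (R : realType) (f : R -> R) (a l : R) :
  (f h - a) / h @[h --> 0^'+] --> l -> f h @[h --> 0^'+] --> a.
Proof.
move=> fl; have h0 : (h : R) @[h --> 0^'+] --> 0 by exact: cvg_at_right_filter.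
have : (f h - a) / h * h + a @[h --> 0^'+] --> l * 0 + a.
  by apply: cvgD; [exact: cvgM|exact: cvg_cst].
rewrite mulr0 add0r; apply: cvg_trans; apply: near_eq_cvg; near=> h.
by rewrite divfK ?subrK // gt_eqF //; near: h; exact: nbhs_right_gt.
Unshelve. all: by end_near. Qed.

Lemma cvg_sumr (R : realType) (T : Type) (F : set_system T) (n : nat)
    (f : 'I_n -> T -> R) (a : 'I_n -> R) : Filter F ->
  (forall i, f i x @[x --> F] --> a i) ->
  \sum_i f i x @[x --> F] --> \sum_i a i.
Proof.
move=> FF fa; apply: (@cvg_big _ _ +%R 0 xpredT) => [|i _]; last exact: fa.
exact: add_continuous.
Qed.

Lemma sum_states (V : nmodType) p (f : 'I_(p + 1) -> V) :
  \sum_x f x = \sum_i f (lshift 1 i) + f (absorbing p).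
Proof. by rewrite big_split_ord big_ord1. Qed.

Section semigroup.
Context {R : realType} {p : nat}.
Variables (T : 'M[R]_p) (S : R -> 'M[R]_(p + 1)).
Hypothesis hS : transition_semigroup (full_intensity T) S.

(** The truncation [Num.max 0 t] extends the absorption probability by [0] to negative times, which
    gives a distribution function on the whole line. *)
Definition absorb_cdf (S : R -> 'M[R]_(p + 1)) (i : 'I_p) (t : R) : R :=
  S (Num.max 0 t) (lshift 1 i) (absorbing p).

Definition trans_block (S : R -> 'M[R]_(p + 1)) (t : R) : 'M[R]_p :=
  ulsubmx (S t).

Local Notation c := (absorb_cdf S).
Local Notation U := (trans_block S).

Lemma semigroup_ge0 (t : R) x y : 0 <= t -> 0 <= S t x y.
Proof. by case: hS => h _ _ _ /h[]. Qed.

Lemma semigroup_sum1 (t : R) x : 0 <= t -> \sum_y S t x y = 1.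
Proof. by case: hS => h _ _ _ /h[]. Qed.

Lemma semigroup_le1 (t : R) x y : 0 <= t -> S t x y <= 1.
Proof.
move=> t0; rewrite -(semigroup_sum1 x t0) (bigD1 y) //= lerDl.
by apply: sumr_ge0 => z _; exact: semigroup_ge0.
Qed.

(* [f t := S t abs abs] is supermultiplicative, so [1 - f] is subadditive, and
   it is [o(h)] at [0]. *)
Lemma semigroup_absorbing (t : R) : 0 <= t -> S t (absorbing p) (absorbing p) = 1.
Proof.
rewrite le_eqVlt => /predU1P[<-|t0].
  by case: hS => _ -> _ _; rewrite mxE eqxx.
have [_ _ SD Sh] := hS.
set a := absorbing p; apply/le_anti/andP; split; first exact/semigroup_le1/ltW.
rewrite -subr_le0.
(* Induction on [n], using [1 - f g <= (1 - f) + (1 - g)] for numbers in [[0, 1]]. *)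
have sub n (h : R) : 0 <= h -> 1 - S (n%:R * h) a a <= n%:R * (1 - S h a a).
  move=> h0; elim: n => [|n IH].
    by case: hS => _ S0 _ _; rewrite !mul0r S0 mxE eqxx subrr.
  rewrite -natr1 !mulrDl !mul1r [n%:R * h + _]addrC SD // ?mulr_ge0 // mxE (bigD1 a) //=.
  have r0 : 0 <= \sum_(i | i != a) S h a i * S (n%:R * h) i a.
    by apply: sumr_ge0 => i _; rewrite mulr_ge0 // semigroup_ge0 // mulr_ge0.
  have := semigroup_le1 a a h0; have := semigroup_ge0 a a h0.
  have nh0 : 0 <= n%:R * h by rewrite mulr_ge0.
  have := semigroup_le1 a a nh0; have := semigroup_ge0 a a nh0.
  move: IH r0; set f := S h a a; set g := S _ a a => *; nra.
have Q0 : full_intensity T a a = 0 by rewrite /full_intensity block_mxEdr mxE.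
have lim : t * ((1 - S h a a) / h) @[h --> 0^'+] --> (0 : R).
  have := Sh a a; rewrite eqxx Q0 => /cvgN/(cvgM (cvg_cst t)).
  rewrite /= oppr0 mulr0; apply: cvg_trans; apply: near_eq_cvg; near=> h.
  by rewrite -mulNr opprB.
(* Along [h = t / n.+1] the factor [t / h] is [n.+1], so [sub] bounds [1 - S t a a] by this null
   sequence. *)
have lim2 : t * ((1 - S (t / n.+1%:R) a a) / (t / n.+1%:R)) @[n --> \oo] --> (0 : R).
  have /cvg_at_rightP := lim; apply; split => [n|]; first by rewrite divr_gt0.
  rewrite -[X in _ --> X](mulr0 t); apply: cvgM; first exact: cvg_cst.
  exact: (@cvg_harmonic R).
apply: (cvgr_to_ge lim2); near=> n.
have n0 : n.+1%:R != 0 :> R by rewrite pnatr_eq0.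
have := sub n.+1 (t / n.+1%:R) (divr_ge0 (ltW t0) (ler0n _ _)).
rewrite mulrCA divff // mulr1 => /le_trans; apply.
rewrite le_eqVlt; apply/orP; left; apply/eqP; field.
by rewrite ?(gt_eqF t0) ?addr1 ?natr1 ?n0 ?nat1r ?n0.
Unshelve. all: by end_near. Qed.

Lemma absorb_cdfE i (t : R) : 0 <= t -> c i t = S t (lshift 1 i) (absorbing p).
Proof. by move=> t0; rewrite /c max_r. Qed.

Lemma absorb_cdf_le0 i (t : R) : t <= 0 -> c i t = 0.
Proof.
move=> t0; rewrite /c max_l //; case: hS => _ -> _ _; rewrite mxE.
by rewrite eq_lrshift.
Qed.

Lemma absorb_cdf_ge0 i t : 0 <= c i t.
Proof. by rewrite semigroup_ge0 // le_max lexx. Qed.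

Lemma absorb_cdf_le1 i t : c i t <= 1.
Proof. by rewrite semigroup_le1 // le_max lexx. Qed.

Lemma trans_block_ge0 (t : R) i j : 0 <= t -> 0 <= U t i j.
Proof. by move=> t0; rewrite !mxE semigroup_ge0. Qed.

Lemma trans_block_le1 (t : R) i j : 0 <= t -> U t i j <= 1.
Proof. by move=> t0; rewrite !mxE semigroup_le1. Qed.

Lemma trans_block_sum (t : R) i : 0 <= t -> \sum_j U t i j = 1 - c i t.
Proof.
move=> t0; rewrite absorb_cdfE // -(semigroup_sum1 (lshift 1 i) t0) sum_states.
by rewrite addrK; apply: eq_bigr => j _; rewrite !mxE.
Qed.

(** Chapman-Kolmogorov at time [h]; the term of the absorbing state reduces to [c i h] by
    [semigroup_absorbing]. *)
Lemma absorb_cdfD i (h t : R) : 0 <= h -> 0 <= t ->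
  c i (h + t) = c i h + \sum_j U h i j * c j t.
Proof.
move=> h0 t0; rewrite absorb_cdfE ?addr_ge0 //.
case: hS => _ _ -> // _; rewrite mxE sum_states semigroup_absorbing // mulr1 addrC.
rewrite absorb_cdfE //; congr (_ + _); apply: eq_bigr => j _.
by rewrite !mxE absorb_cdfE.
Qed.

Lemma absorb_surv_add i (h t : R) : 0 <= h -> 0 <= t ->
  1 - c i (h + t) = \sum_j U h i j * (1 - c j t).
Proof.
move=> h0 t0; rewrite absorb_cdfD // opprD addrA -trans_block_sum // -sumrB.
by apply: eq_bigr => j _; rewrite mulrBr mulr1.
Qed.

(** By [absorb_cdfD] the increment is a combination of the [c j (t - s)] with coefficients in
    [[0, 1]]. The bound depends on [t - s] alone, so it is a uniform modulus of continuity; negative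
    times reduce to [0], where [c] still vanishes. *)
Lemma absorb_cdf_incr i (s t : R) : s <= t ->
  0 <= c i t - c i s <= \sum_j c j (t - s).
Proof.
have pos i' (u v : R) : 0 <= u -> u <= v -> 0 <= c i' v - c i' u <= \sum_j c j (v - u).
  move=> u0 uv; have vu : 0 <= v - u by rewrite subr_ge0.
  have -> : c i' v = c i' (u + (v - u)) by rewrite subrKC.
  rewrite absorb_cdfD // addrAC subrr add0r; apply/andP; split.
    by apply: sumr_ge0 => j _; rewrite mulr_ge0 ?absorb_cdf_ge0 // trans_block_ge0.
  apply: ler_sum => j _; rewrite ler_piMl ?absorb_cdf_ge0 //.
  exact: trans_block_le1.
move=> st; have [s0|s0] := leP 0 s; first exact: pos.
have [t0|t0] := leP t 0.
  rewrite !(absorb_cdf_le0 i) ?(ltW s0) // subrr lexx /=.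
  by apply: sumr_ge0 => j _; exact: absorb_cdf_ge0.
have /andP[h1 h2] := pos i 0 t (lexx _) (ltW t0).
rewrite (absorb_cdf_le0 i (lexx 0)) in h1 h2.
rewrite (absorb_cdf_le0 i (ltW s0)) h1 /=.
apply: le_trans h2 _; apply: ler_sum => j _; rewrite subr0.
have ts : t <= t - s by rewrite lerDl oppr_ge0 ltW.
by have /andP[] := pos j t (t - s) (ltW t0) ts; rewrite subr_ge0.
Qed.

Lemma absorb_cdf_homo i : {homo c i : s t / s <= t}.
Proof. by move=> s t /(absorb_cdf_incr i)/andP[]; rewrite subr_ge0. Qed.

Lemma cvg_trans_block_rate i j :
  (U h i j - (i == j)%:R) / h @[h --> 0^'+] --> T i j.
Proof.
have [_ _ _ /(_ (lshift 1 i) (lshift 1 j))] := hS.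
rewrite /full_intensity block_mxEul (inj_eq (@lshift_inj _ _)).
by apply: cvg_trans; apply: near_eq_cvg; near=> h; rewrite !mxE.
Unshelve. all: by end_near. Qed.

Lemma cvg_absorb_cdf_rate i : c i h / h @[h --> 0^'+] --> exit_rates T i 0.
Proof.
have [_ _ _ /(_ (lshift 1 i) (absorbing p))] := hS.
rewrite /full_intensity block_mxEur eq_lrshift.
apply: cvg_trans; apply: near_eq_cvg; near=> h.
by rewrite subr0 absorb_cdfE.
Unshelve. all: by end_near. Qed.

Lemma cvg_absorb_cdf0 i : c i h @[h --> 0^'+] --> (0 : R).
Proof.
apply: (@cvg_of_quotient _ _ _ (exit_rates T i 0)).
have := @cvg_absorb_cdf_rate i; apply: cvg_trans; apply: near_eq_cvg; near=> h.
by rewrite subr0.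
Unshelve. all: by end_near. Qed.

Lemma cvg_absorb_cdf_sum0 : \sum_i c i h @[h --> 0^'+] --> (0 : R).
Proof.
have := cvg_sumr (F := (0 : R)^'+) (f := c) (a := fun=> 0).
rewrite big1 //; apply => i; exact: cvg_absorb_cdf0.
Qed.

(** Uniformity in [t] serves twice: for right continuity, and for the absence of atoms in
    [prob_lt]. *)
Lemma absorb_cdf_modulus (e : R) : 0 < e ->
  \forall h \near 0^'+, forall i t, c i (t + h) - c i t <= e.
Proof.
move=> e0; have /cvgrPdist_le/(_ e e0) := cvg_absorb_cdf_sum0.
move=> He; near=> h => i t.
have h0 : 0 < h by near: h; exact: nbhs_right_gt.
have /(absorb_cdf_incr i)/andP[_] : t <= t + h by rewrite lerDl ltW.
move=> /le_trans; apply; rewrite [t + h]addrC addrK.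
have : `|0 - \sum_j c j h| <= e by near: h.
by rewrite sub0r normrN; apply: le_trans; exact: ler_norm.
Unshelve. all: by end_near. Qed.

Lemma absorb_cdf_right_continuous i : right_continuous (c i).
Proof.
move=> x; apply/cvgrPdist_le => e e0; apply/nbhs_right0P.
have He := absorb_cdf_modulus e0; near=> h.
have h0 : 0 < h by near: h; exact: nbhs_right_gt.
rewrite distrC ger0_norm ?subr_ge0 ?absorb_cdf_homo ?lerDl ?(ltW h0) //.
by near: h; apply: filterS He => h /(_ i x).
Unshelve. all: by end_near. Qed.

End semigroup.

(** * Measures on the real line *)

Lemma nat_gt_norm (R : archiRealDomainType) (x : R) :
  exists n, - n%:R < x < n%:R.
Proof. by exists (Num.bound `|x|); rewrite -ltr_norml archi_boundP. Qed.

Lemma bigcup_itv_ninfty (R : realType) (x : R) :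
  `]-oo, x]%classic = \bigcup_n `](- n%:R), x]%classic.
Proof.
apply/seteqP; split => y /=; rewrite in_itv /=.
  move=> yx.
  have [n /andP[ny _]] := nat_gt_norm y.
  by exists n => //=; rewrite in_itv /= yx ny.
by case=> n _ /=; rewrite in_itv /= => /andP[].
Qed.

Lemma measure_ocitv (R : realType) (m : {measure set R -> \bar R}) (a b : R) :
  (m `]-oo, b]%classic < +oo)%E -> a <= b ->
  (m `]a, b]%classic = m `]-oo, b]%classic - m `]-oo, a]%classic)%E.
Proof.
move=> moo ab.
have -> : `]a, b]%classic = `]-oo, b] `\` `]-oo, a].
  apply/seteqP; split => y /=; rewrite !in_itv /=.
    by move=> /andP[ay yb]; split => //; apply/negP; rewrite -ltNge.
  by move=> [yb /negP]; rewrite -ltNge => ->.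
by rewrite measureD // setIidr //; exact: subset_itvl.
Qed.

(** Half-open intervals form a generating family stable under intersection, and their masses are
    differences of masses of rays. *)
Lemma measure_eq_rays (R : realType) (m1 m2 : {measure set R -> \bar R}) :
  (m1 setT < +oo)%E -> (forall x : R, m1 `]-oo, x]%classic = m2 `]-oo, x]%classic) ->
  forall A, measurable A -> m1 A = m2 A.
Proof.
move=> m1oo m12; have m1fin A : measurable A -> (m1 A < +oo)%E.
  by move=> mA; apply: le_lt_trans m1oo; apply: le_measure; rewrite ?inE.
have Eab (a b : R) : m1 `]a, b]%classic = m2 `]a, b]%classic.
  have [ab|ba] := leP a b; last by rewrite set_itv_ge ?measure0 // bnd_simp -leNgt ltW.
  by rewrite !measure_ocitv // -?m12 // m1fin.
apply: (measure_unique (@ocitv R) (fun k => `](- k%:R), k%:R]%classic)) => //.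
- exact: ocitvI.
- by move=> k; exists (- k%:R, k%:R).
- rewrite -subTset => x _ /=; have [n /andP[nx xn]] := nat_gt_norm x.
  by exists n => //=; rewrite in_itv /= nx ltW.
- by move=> _ [[a b] _ <-].
- by move=> k; exact: m1fin.
Qed.

Lemma lebesgue_stieltjes_ocitv (R : realType) (f : cumulative R R) (a b : R) :
  a <= b -> lebesgue_stieltjes_measure f `]a, b]%classic = (f b - f a)%:E.
Proof.
move=> ab; rewrite /lebesgue_stieltjes_measure /measure_extension /=.
rewrite measurable_mu_extE /=; last exact: is_ocitv.
by rewrite wlength_itv_bnd.
Qed.

(** This is the Lebesgue-Stieltjes measure of [f]. The limit of [f] at infinity is not known here,
    so the total mass is only bounded by 1; equality is recovered in [absorb_mass]. *)
Lemma cumulative_measure (R : realType) (f : R -> R) :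
  {homo f : x y / x <= y} ->
  right_continuous f ->
  (forall x : R, x <= 0 -> f x = 0) -> (forall x, f x <= 1) ->
  exists m : {finite_measure set R -> \bar R},
    (m setT <= 1)%E /\ forall x : R, m `]-oo, x]%classic = (f x)%:E.
Proof.
move=> nd rc f0 f1.
pose g : cumulative R R := HB.pack f (isCumulative.Build R _ R f nd rc).
pose m0 : {measure set (measurableTypeR R) -> \bar R} :=
  lebesgue_stieltjes_measure g.
(* The Stieltjes measure lives on [measurableTypeR R]; pushing it forward along the identity moves
   it to the measurable structure of [R]. *)
have mid : measurable_fun setT (idfun : measurableTypeR R -> R).
  exact: measurable_id.
pose m : {measure set R -> \bar R} := push_measure m0 mid.
have mab (a b : R) : a <= b -> m `]a, b]%classic = (f b - f a)%:E.
  exact: (lebesgue_stieltjes_ocitv g).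
have mray (x : R) : m `]-oo, x]%classic = (f x)%:E.
  have h1 : m `](- n%:R), x]%classic @[n --> \oo] --> m `]-oo, x]%classic.
    rewrite bigcup_itv_ninfty; apply: nondecreasing_cvg_mu => //.
      exact: bigcup_measurable.
    by move=> *; apply/subsetPset/subset_itv; rewrite leBSide//= lerN2 ler_nat.
  apply: (cvg_unique _ h1) => //; apply: cvg_near_cst.
  near=> n; have nx : - n%:R <= x by rewrite lerNl; near: n; exact: nbhs_infty_ger.
  by rewrite mab // [f (- _)]f0 ?subr0 // oppr_le0.
suff mT : (m setT <= 1)%E.
  have mfin : fin_num_fun m.
    move=> A mA; rewrite ge0_fin_numE //; apply: le_lt_trans (ltry 1).
    by apply: le_trans mT; apply: le_measure; rewrite ?inE.
  pose mf : {finite_measure set R -> \bar R} :=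
    HB.pack (Measure.sort m) m (Measure_isFinite.Build _ _ _ m mfin).
  by exists mf.
have h1 : m `]-oo, n%:R]%classic @[n --> \oo] --> m setT.
  have -> : [set: R] = \bigcup_n `]-oo, n%:R]%classic.
    apply/seteqP; split => // x _; have [n /andP[_ xn]] := nat_gt_norm x.
    by exists n => //=; rewrite in_itv /= ltW.
  apply: nondecreasing_cvg_mu => //; first exact: bigcup_measurable.
  by move=> *; apply/subsetPset/subset_itvl; rewrite bnd_simp ler_nat.
rewrite -(cvg_lim _ h1) //; apply: lime_le; first by apply/cvg_ex; exists (m setT).
by near=> n; rewrite mray lee_fin.
Unshelve. all: by end_near. Qed.

(** * Finite nonnegative combinations of measures *)

Section weighted_sum.
Context {d : measure_display} {T : measurableType d} {R : realType} {n : nat}.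
Variables (a : 'I_n -> {nonneg R}) (m : 'I_n -> {measure set T -> \bar R}).

(** [msum] is indexed by [nat], whence [insub]; the default [mzero] is never reached for indices
    below [n]. *)
Definition weighted_measure : {measure set T -> \bar R} :=
  msum (fun k => if insub k is Some i then mscale (a i) (m i) else mzero) n.

Lemma weighted_measureE A :
  weighted_measure A = (\sum_i (a i)%:num%:E * m i A)%E.
Proof.
rewrite /weighted_measure /= /msum; apply: eq_bigr => i _.
by rewrite valK.
Qed.

Lemma integral_weighted_measure (f : T -> \bar R) D : measurable D ->
  measurable_fun D f -> (forall x, D x -> 0 <= f x)%E ->
  (\int[weighted_measure]_(x in D) f x =
   \sum_i (a i)%:num%:E * \int[m i]_(x in D) f x)%E.
Proof.
move=> mD mf f0; rewrite /weighted_measure ge0_integral_measure_sum //.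
by apply: eq_bigr => i _; rewrite valK ge0_integral_mscale.
Qed.

(** The decomposition is required only inside [D], because the shifted absorption laws decompose
    only on positive times. *)
Lemma integral_weighted (mu : {measure set T -> \bar R}) (f : T -> \bar R) D :
  (forall A, measurable A -> A `<=` D ->
    mu A = \sum_i (a i)%:num%:E * m i A)%E ->
  measurable D -> measurable_fun D f -> (forall x, D x -> 0 <= f x)%E ->
  (\int[mu]_(x in D) f x = \sum_i (a i)%:num%:E * \int[m i]_(x in D) f x)%E.
Proof.
move=> muE mD mf f0; rewrite -integral_weighted_measure //.
by apply: eq_measure_integral => A mA AD; rewrite muE // -weighted_measureE.
Qed.

End weighted_sum.

(** * The renewal equation *)

Section lyapunov.
Context {R : realType} {p : nat}.
Variables (T : 'M[R]_p) (S : R -> 'M[R]_(p + 1)).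
Hypothesis hS : transition_semigroup (full_intensity T) S.

Local Notation c := (absorb_cdf S).
Local Notation U := (trans_block S).

(* Divide by [h] and let [h] tend to [0]. *)
Lemma lyapunov_of_renewal (M : 'M[R]_p) :
  (forall i j (h : R), 0 < h ->
    (1 - c i h) * c j h <= (M - U h *m M *m (U h)^T) i j <= c j h) ->
  exit_lyapunov T M.
Proof.
move=> MU i j.
pose A h : 'M[R]_p := \matrix_(a, b) ((U h a b - (a == b)%:R) / h).
have UA (h : R) : 0 < h -> U h = 1%:M + h *: A h.
  move=> h0; apply/matrixP => a b.
  rewrite [RHS]mxE [X in _ = X + _]mxE [X in _ = _ + X]mxE [A h a b]mxE.
  by field; rewrite gt_eqF.
have Acvg a b : A h a b @[h --> 0^'+] --> T a b.
  have := @cvg_trans_block_rate _ _ _ _ hS a b; apply: cvg_trans; apply: near_eq_cvg.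
  by near=> h; rewrite [A h a b]mxE.
have AMcvg (N : 'M[R]_p) a b : (A h *m N) a b @[h --> 0^'+] --> (T *m N) a b.
  rewrite mxE; under eq_cvg => h do rewrite mxE.
  by apply: cvg_sumr => k; apply: cvgM => //; exact: cvg_cst.
have NAcvg (f : R -> 'M[R]_p) (N : 'M[R]_p) a b :
    (forall a b, f h a b @[h --> 0^'+] --> N a b) ->
    (f h *m (A h)^T) a b @[h --> 0^'+] --> (N *m T^T) a b.
  move=> fN; rewrite mxE; under eq_cvg => h do rewrite mxE.
  apply: cvg_sumr => k; apply: cvgM => //; rewrite mxE.
  by under eq_cvg => h do rewrite mxE; exact: Acvg.
have id0 : (h : R) @[h --> 0^'+] --> (0 : R) by exact: cvg_at_right_filter.
have lim1 : (M - U h *m M *m (U h)^T) i j / h @[h --> 0^'+] -->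
    - (T *m M + M *m T^T) i j.
  (* With [U = 1 + h A], one has [M - U M U^T = - h (A M + M A^T + h A M A^T)]; after division by
     [h] the quadratic term still carries a factor [h]. *)
  have : - ((A h *m M) i j + (M *m (A h)^T) i j + h * (A h *m M *m (A h)^T) i j)
      @[h --> 0^'+] --> - ((T *m M) i j + (M *m T^T) i j + 0 * (T *m M *m T^T) i j).
    apply: cvgN; apply: cvgD; first apply: cvgD => //.
      by apply: (NAcvg (fun=> M)) => a b; exact: cvg_cst.
    apply: cvgM => //; exact: NAcvg.
  rewrite mul0r addr0 [X in _ --> - X](_ : _ = (T *m M + M *m T^T) i j);
    last by rewrite [RHS]mxE.
  apply: cvg_trans; apply: near_eq_cvg; near=> h.
  have h0 : 0 < h by near: h; exact: nbhs_right_gt.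
  rewrite UA // [(1%:M + _)^T]linearD /= trmx1 [(h *: _)^T]linearZ /=.
  rewrite !mulmxDl !mulmxDr !mul1mx !mulmx1.
  rewrite -?scalemxAl -?scalemxAr -?scalemxAl.
  move: (A h *m M *m (A h)^T) (A h *m M) (M *m (A h)^T) => X Y Z.
  by rewrite !mxE; field; rewrite gt_eqF.
have lim2 : (M - U h *m M *m (U h)^T) i j / h @[h --> 0^'+] --> exit_rates T j 0.
  (* Divided by [h], both bounds tend to the exit rate of [j], since [c i h] tends to 0. *)
  apply: (@squeeze_cvgr _ _ _ _ (fun h => (1 - c i h) * (c j h / h)) (fun h => c j h / h)).
  - near=> h; have h0 : 0 < h by near: h; exact: nbhs_right_gt.
    by have /andP[h1 h2] := MU i j h h0; rewrite mulrA !ler_pM2r ?invr_gt0 // h1.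
  - rewrite -[X in _ --> X]mul1r; apply: cvgM; last exact: (@cvg_absorb_cdf_rate _ _ _ _ hS j).
    rewrite -[X in _ --> X]subr0; apply: cvgB; first exact: cvg_cst.
    exact: (@cvg_absorb_cdf0 _ _ _ _ hS i).
  - exact: (@cvg_absorb_cdf_rate _ _ _ _ hS j).
rewrite -[LHS]opprK; congr (- _); exact: cvg_unique lim1 lim2.
Unshelve. all: by end_near. Qed.

Variable m : 'I_p -> {measure set R -> \bar R}.
Hypothesis m1 : forall j, (m j setT <= 1)%E.
Hypothesis mc : forall j (x : R), m j `]-oo, x]%classic = (c j x)%:E.

Let pos : set R := `]0, +oo[%classic.

Let measurable_pos : measurable pos. Proof. exact: measurable_itv. Qed.

(** Markov property at time [h] for the absorption law: past [h], the remaining time is a mixture of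
    the laws [m k] weighted by the state at [h]. The condition [A <= pos] excludes absorption before
    [h]; on rays the identity is [absorb_cdfD]. *)
Lemma absorb_measure_shift j (h : R) A : 0 <= h -> measurable A -> A `<=` pos ->
  m j ((fun x => x - h) @^-1` A) = (\sum_k (U h j k)%:E * m k A)%E.
Proof.
move=> h0 mA A0.
have mH : measurable (`]h, +oo[%classic : set R) by exact: measurable_itv.
have mphi : measurable_fun setT (fun x : R => x - h).
  by apply: measurable_funB => //; exact: measurable_cst.
pose a k : {nonneg R} := NngNum (trans_block_ge0 hS j k h0).
have /(_ A mA) : forall A, measurable A ->
    push_measure (mrestr (m j) mH) mphi A = weighted_measure a m A.
  apply: measure_eq_rays => [|x].
    rewrite /= /pushforward /mrestr; apply: le_lt_trans (ltry 1).
    apply: le_trans (m1 j); apply: le_measure; rewrite ?inE //.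
    by rewrite preimage_setT; exact: measurableI.
  rewrite weighted_measureE /= /pushforward /mrestr.
  under eq_bigr => k _ do rewrite mc -EFinM.
  rewrite sumEFin.
  have [x0|x0] := leP x 0.
    rewrite big1 => [|k _]; last by rewrite (absorb_cdf_le0 hS k x0) mulr0.
    rewrite (_ : _ `&` _ = set0) ?measure0 //.
    apply/seteqP; split => // y [/=]; rewrite !in_itv /= andbT.
    by move=> yx hy; lra.
  rewrite (_ : _ `&` _ = `]h, h + x]%classic); last first.
    apply/seteqP; split => y /=; rewrite !in_itv /= ?andbT.
      by move=> [yx hy]; apply/andP; split; lra.
    by move=> /andP[hy yx]; split; lra.
  rewrite measure_ocitv ?mc ?ltry ?lerDl ?(ltW x0) // -EFinB.
  by rewrite (absorb_cdfD hS) ?(ltW x0) // addrAC subrr add0r.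
rewrite weighted_measureE /= /pushforward /mrestr => <-; congr (m j _).
apply/seteqP; split => y /= => [Ay|[]//]; split => //.
by have := A0 _ Ay; rewrite /pos /= !in_itv /= !andbT subr_gt0.
Qed.

Lemma measurable_absorb_cdf i : measurable_fun setT (c i).
Proof. by apply: nondecreasing_measurable => // s t; exact: (absorb_cdf_homo hS). Qed.

Lemma measurable_absorb_surv i (D : set R) :
  measurable_fun D (fun x => (1 - c i x)%:E).
Proof.
apply: measurable_funTS; apply/measurable_EFinP; apply: measurable_funB.
  exact: measurable_cst.
exact: measurable_absorb_cdf.
Qed.

Lemma absorb_surv_ge0 i x : (0 <= (1 - c i x)%:E)%E.
Proof. by rewrite lee_fin subr_ge0 (absorb_cdf_le1 hS). Qed.

Local Notation J i j := (\int[m j]_(x in pos) (1 - c i x)%:E)%E.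

(** Both processes are restarted at [h]: the integrating law by [absorb_measure_shift], the
    integrand by [absorb_surv_add]. The result is the entry of [U M U^T]. *)
Lemma integral_absorb_shift i j (h : R) : 0 <= h ->
  (\int[m j]_(x in `]h, +oo[) (1 - c i x)%:E =
   \sum_k (U h j k)%:E * \sum_l (U h i l)%:E * J l k)%E.
Proof.
move=> h0.
have mphi : measurable_fun setT (fun x : R => x - h).
  by apply: measurable_funB => //; exact: measurable_cst.
have mpsi : measurable_fun setT (fun x : R => h + x).
  by apply: measurable_funD => //; exact: measurable_cst.
pose a k : {nonneg R} := NngNum (trans_block_ge0 hS j k h0).
transitivity (\int[push_measure (m j) mphi]_(x in pos) (1 - c i (h + x))%:E)%E.
  rewrite (ge0_integral_pushforward mphi) //.
  - rewrite [_ @^-1` _](_ : _ = `]h, +oo[%classic).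
      by apply: eq_integral => x _ /=; rewrite subrKC.
    by apply/seteqP; split => x; rewrite /pos /= !in_itv /= !andbT subr_gt0.
  - apply: measurable_funTS; apply: (measurableT_comp _ mpsi (f := fun x => (1 - c i x)%:E)).
    exact: measurable_absorb_surv.
  - by move=> x _; exact: absorb_surv_ge0.
rewrite (@integral_weighted _ _ _ _ a m) //; first last.
- by move=> x _; exact: absorb_surv_ge0.
- apply: measurable_funTS; apply: (measurableT_comp _ mpsi (f := fun x => (1 - c i x)%:E)).
  exact: measurable_absorb_surv.
- by move=> A mA A0; exact: absorb_measure_shift.
apply: eq_bigr => k _; congr (_ * _)%E.
transitivity (\int[m k]_(x in pos) \sum_l ((U h i l)%:E * (1 - c l x)%:E))%E.
  apply: eq_integral => x; rewrite inE /pos /= in_itv /= andbT => x0.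
  by rewrite (absorb_surv_add hS) ?(ltW x0) // -sumEFin.
rewrite ge0_integral_sum //.
- apply: eq_bigr => l _; rewrite ge0_integralZl //.
  + exact: measurable_absorb_surv.
  + by move=> x _; exact: absorb_surv_ge0.
  + by rewrite lee_fin (trans_block_ge0 hS).
- move=> l; apply: measurable_funeM; exact: measurable_absorb_surv.
- move=> l x _; apply: mule_ge0; last exact: absorb_surv_ge0.
  by rewrite lee_fin (trans_block_ge0 hS).
Qed.

(** The matrix [M] of the overview. Integrating over [pos] loses nothing, as [m j] gives mass
    [c j 0 = 0] to the other half-line. *)
Definition absorb_order_mx : 'M[R]_p := \matrix_(i, j) fine (J i j).

Lemma absorb_order_mxE i j : J i j = (absorb_order_mx i j)%:E.
Proof.
rewrite mxE fineK // ge0_fin_numE; last first.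
  by apply: integral_ge0 => x _; exact: absorb_surv_ge0.
apply: le_lt_trans (ltry 1); apply: le_trans (m1 j).
apply: (@le_trans _ _ (\int[m j]_(x in pos) 1)%E).
  apply: ge0_le_integral => //.
  - by move=> x _; exact: absorb_surv_ge0.
  - exact: measurable_absorb_surv.
  - by move=> x _; rewrite lee_fin gerBl (absorb_cdf_ge0 hS).
by rewrite integral_cst // mul1e; apply: le_measure; rewrite ?inE.
Qed.

(** The integral is cut at [h]. Beyond [h] it is the entry of [U M U^T]; on []0, h]] the survival
    function lies between [1 - c i h] and [1], which gives the two bounds of
    [lyapunov_of_renewal]. *)
Lemma absorb_order_lyapunov : exit_lyapunov T absorb_order_mx.
Proof.
apply: lyapunov_of_renewal => i j h h0; have h0' := ltW h0.
have mI (D : set R) : measurable_fun D (fun x => (1 - c i x)%:E).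
  exact: measurable_absorb_surv.
have I0 (D : set R) x : D x -> (0 <= (1 - c i x)%:E)%E.
  by move=> _; exact: absorb_surv_ge0.
pose I : set R := `]0, h]%classic.
have mh : measurable I by exact: measurable_itv.
have mh0 : m j I = (c j h)%:E.
  rewrite /I measure_ocitv ?mc ?ltry // -EFinB.
  by rewrite (absorb_cdf_le0 hS j (lexx 0)) subr0.
have split_h : (J i j = \int[m j]_(x in I) (1 - c i x)%:E +
    \int[m j]_(x in `]h, +oo[) (1 - c i x)%:E)%E.
  have -> : pos = I `|` `]h, +oo[%classic.
    apply/seteqP; split => x; rewrite /pos /I /= !in_itv /= !andbT.
      by move=> ->; case: (leP x h); [left|right].
    by case=> [/andP[]//|]; exact: lt_trans.
  rewrite ge0_integral_setU //.
  - by move=> x; exact: I0.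
  - rewrite disj_set2E /I; apply/eqP/seteqP; split => // x [] /=.
    by rewrite !in_itv /= andbT => /andP[_ xh]; rewrite ltNge xh.
have hi : (\int[m j]_(x in I) (1 - c i x)%:E <= (c j h)%:E)%E.
  rewrite -mh0 -[leRHS]mul1e -integral_cst //; apply: ge0_le_integral => //.
  - by move=> x; exact: I0.
  - by move=> x _; rewrite lee_fin gerBl (absorb_cdf_ge0 hS).
have lo : (((1 - c i h) * c j h)%:E <= \int[m j]_(x in I) (1 - c i x)%:E)%E.
  rewrite EFinM -mh0 -integral_cst //; apply: ge0_le_integral => //.
  - by move=> x _; exact: absorb_surv_ge0.
  - move=> x; rewrite /I /= in_itv /= => /andP[_ xh].
    by rewrite lee_fin lerD2l lerN2 (absorb_cdf_homo hS).
have : (\int[m j]_(x in I) (1 - c i x)%:E =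
    ((absorb_order_mx - U h *m absorb_order_mx *m (U h)^T) i j)%:E)%E.
  move: split_h; rewrite integral_absorb_shift // absorb_order_mxE.
  under eq_bigr => k _ do
    (under eq_bigr => l _ do rewrite absorb_order_mxE -EFinM; rewrite sumEFin -EFinM).
  rewrite sumEFin => /eqP; rewrite -sube_eq ?fin_num_adde_defl // => /eqP <-.
  rewrite -EFinB; congr EFin; rewrite [RHS]mxE; congr (_ + _).
  rewrite [RHS]mxE; congr (- _); rewrite [RHS]mxE; apply: eq_bigr => k _.
  by rewrite mulrC [X in _ = X * _]mxE [X in _ = _ * X]mxE.
by move=> E; move: lo hi; rewrite E !lee_fin => -> ->.
Qed.

End lyapunov.

(** * Absorption times of Markov jump processes *)

Lemma at_right_itv (R : realType) (x : R) (Q : R -> Prop) :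
  (\forall s \near x^'+, Q s) ->
  exists2 e, 0 < e & forall s, x < s < x + e -> Q s.
Proof.
rewrite near_withinE => /nbhs_ballP[e /= e0 H]; exists e => // s /andP[xs se].
apply: H => //; rewrite /ball /= ltr_distlC; apply/andP; split; lra.
Qed.

Section absorption.
Context {R : realType} {d : measure_display} {Omega : measurableType d}.
Variables (P : probability Omega R) (p : nat) (T : 'M[R]_p).
Variables (J : R -> Omega -> 'I_(p + 1)) (S : R -> 'M[R]_(p + 1)).
Hypothesis hS : transition_semigroup (full_intensity T) S.
Hypothesis mJ : forall (t : R) x, 0 <= t -> measurable (J t @^-1` [set x]).
Hypothesis rcJ : forall w (t : R), 0 <= t -> \forall s \near t^'+, J s w = J t w.
Hypothesis markovJ : forall (s t : R) (x y : 'I_(p + 1)) (hist : seq (R * 'I_(p + 1))),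
  0 <= s -> 0 <= t -> (forall u, u \in hist -> 0 <= u.1 <= s) ->
  (0 < P (J s @^-1` [set x] `&` history J hist))%E ->
  cond_prob P (J (s + t) @^-1` [set y])
              (J s @^-1` [set x] `&` history J hist) = S t x y.

Lemma markov_transition (s t : R) x y : 0 <= s -> 0 <= t ->
  (0 < P (J s @^-1` [set x]))%E ->
  cond_prob P (J (s + t) @^-1` [set y]) (J s @^-1` [set x]) = S t x y.
Proof.
move=> s0 t0 Px.
have E : J s @^-1` [set x] = J s @^-1` [set x] `&` history J [::].
  by apply/seteqP; split => w //= [].
by rewrite E markovJ // -E.
Qed.

Lemma markov_absorbing (s t : R) : 0 <= s -> s <= t ->
  {ae P, forall w, J s w = absorbing p -> J t w = absorbing p}.
Proof.
move=> s0 st; have t0 := le_trans s0 st.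
set A := J s @^-1` [set absorbing p]; set B := J t @^-1` [set absorbing p].
have mA : measurable A by exact: mJ.
have mB : measurable B by exact: mJ.
have mAB : measurable (A `\` B) by exact: measurableD.
have PAB : P (A `\` B) = 0%E.
  have [PA|PA] := eqVneq (P A) 0%E.
    by apply/eqP; rewrite -measure_le0 -[leRHS]PA; apply: le_measure; rewrite ?inE //.
  have PA0 : (0 < P A)%E by rewrite lt0e PA measure_ge0.
  have ts : 0 <= t - s by rewrite subr_ge0.
  have := markov_transition (absorbing p) s0 ts PA0.
  rewrite subrKC (semigroup_absorbing hS) ?subr_ge0 //.
  rewrite /cond_prob -/A -/B setIC => /GRing.divr1_eq PBA.
  have -> : P (A `\` B) = (P A - P (A `&` B))%E.
    by apply: measureD => //; rewrite ltey_eq fin_num_measure.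
  by rewrite -[P (A `&` B)]fineK ?fin_num_measure ?PBA ?fineK ?subee //;
    rewrite ?fin_num_measure //; exact: measurableI.
exists (A `\` B); split => //.
by move=> w /= /not_implyP.
Qed.

(** Absorption persists almost surely only for a fixed pair of times. Countably many null sets, one
    per rational time, suffice, since right continuity puts an absorbed path in the absorbing state
    at some rational time. *)
Lemma absorption_time_le (t : R) (X : {RV P >-> R}) : 0 <= t ->
  {ae P, forall w, (X w)%:E = absorption_time J w} ->
  {ae P, forall w, X w <= t <-> J t w = absorbing p}.
Proof.
move=> t0 aeX.
(* Rationals are enumerated through [unpickle], so that [ae_foralln] applies. *)
pose Q (n : nat) w := if @unpickle rat n is Some q then
    0 <= (ratr q : R) <= t -> J (ratr q) w = absorbing p -> J t w = absorbing p else True.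
have aeq : {ae P, forall w n, Q n w}.
  apply: (@ae_foralln _ _ _ P Q) => n; rewrite /Q; case: (unpickle n) => [q|]; last exact: aeW.
  have [/andP[q0 qt]|nq] := boolP (0 <= (ratr q : R) <= t); last first.
    by apply: aeW => w.
  by have := markov_absorbing q0 qt; apply: filterS => w + _.
apply: filterS2 aeX aeq => w Xw Jq; split => [Xt|].
- set x := X w in Xt Xw.
  have x0 : 0 <= x.
    rewrite -lee_fin Xw; apply: le_ereal_inf_tmp => _ [s [s0 _] <-].
    by rewrite lee_fin ltW.
  have [e e0 He] := at_right_itv (rcJ w x0).
  (* The infimum is attained: some absorbed time lies in [[x, x + e[], and the path is constant
     there. *)
  have Jx : J x w = absorbing p.
    have : (absorption_time J w < (x + e)%:E)%E by rewrite -Xw lte_fin ltrDl.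
    move=> /ereal_inf_lt[_ [s [s0 Js] <-]]; rewrite lte_fin => sxe.
    have : x <= s by rewrite -lee_fin Xw; apply: ereal_inf_lbound; exists s.
    rewrite le_eqVlt => /predU1P[->//|xs].
    by rewrite -(He s) // xs.
  move: Xt; rewrite le_eqVlt => /predU1P[<-//|xt].
  have [q] : exists q, (ratr q : R) \in `]x, Num.min t (x + e)[.
    by apply: rat_in_itvoo; rewrite lt_min xt ltrDl.
  rewrite in_itv /= lt_min => /and3P[xq qt qe].
  have := Jq (pickle q); rewrite /Q pickleK; apply.
    by rewrite (ltW (le_lt_trans x0 xq)) ltW.
  by rewrite He // xq.
- move=> Jt; rewrite -lee_fin Xw.
  (* The infimum ranges over strictly positive times, so [t = 0] needs right continuity to produce
     arbitrarily small absorbed times. *)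
  move: t0; rewrite le_eqVlt => /predU1P[t0|t0]; last first.
    by apply: ereal_inf_lbound; exists t.
  have [e e0 He] := at_right_itv (rcJ w (lexx 0)).
  rewrite -t0; apply/lee_addgt0Pr => r r0; rewrite add0e.
  pose s := Num.min (e / 2) r.
  have s0 : 0 < s by rewrite lt_min divr_gt0.
  apply: (@le_trans _ _ s%:E); last by rewrite lee_fin ge_min lexx orbT.
  apply: ereal_inf_lbound; exists s => //; split => //.
  have -> : J s w = J 0 w.
    by apply: He; rewrite s0 add0r gt_min; apply/orP; left; lra.
  by rewrite t0.
Qed.

End absorption.

(** * Joint law and order probabilities *)

Lemma integral_product_mul d1 d2 (T1 : measurableType d1) (T2 : measurableType d2)
    (R : realType) (m1 : {sigma_finite_measure set T1 -> \bar R})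
    (m2 : {sigma_finite_measure set T2 -> \bar R})
    (f : T1 -> \bar R) (g : T2 -> \bar R) :
  measurable_fun setT f -> measurable_fun setT g ->
  (forall x, 0 <= f x)%E -> (forall x, 0 <= g x)%E ->
  (\int[m1 \x m2]_z (f z.1 * g z.2) = (\int[m1]_x f x) * (\int[m2]_y g y))%E.
Proof.
move=> mf mg f0 g0; rewrite fubini_tonelli1; first last.
- by move=> z; rewrite mule_ge0.
- apply: emeasurable_funM; first exact: measurableT_comp.
  exact: measurableT_comp.
under eq_integral => x _ do rewrite /fubini_F /= ge0_integralZl //.
by rewrite ge0_integralZr // integral_ge0.
Qed.

(** Once the first coordinate is fixed, the two events concern different independent coordinates.
    The section in [w.2] is taken first, then Tonelli separates [w.1.2]. *)
Lemma product_measure3_sections d (Omega : measurableType d) (R : realType)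
    (P : probability Omega R) (U V : set (Omega * Omega)) :
  measurable U -> measurable V ->
  ((P \x P) \x P)%E [set w | U (w.1.1, w.2) /\ V (w.1.1, w.1.2)] =
  (\int[P]_w (P (xsection U w) * P (xsection V w)))%E.
Proof.
move=> mU mV; rewrite [LHS]/product_measure1 /=.
have mPU : measurable_fun setT (P \o xsection U) by exact: measurable_fun_xsection.
have mind : measurable_fun setT (fun z : Omega * Omega => (\1_V z : R)%:E).
  by apply/measurable_EFinP; exact: measurable_indic.
transitivity (\int[P \x P]_z ((P \o xsection U) z.1 * (\1_V z)%:E))%E.
  apply: eq_integral => -[w w'] _ /=; rewrite indicE.
  have [Vw|Vw] := boolP ((w, w') \in V).
    rewrite mule1; congr (P _); apply/seteqP; split => v; rewrite /xsection /= !inE /=.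
      by case.
    by move=> ?; split => //; move: Vw; rewrite inE.
  rewrite mule0 (_ : xsection _ _ = set0) ?measure0 //.
  apply/seteqP; split => v //; rewrite /xsection /= inE /= => -[_ Vww].
  by move: Vw; rewrite notin_setE.
rewrite fubini_tonelli1 //; first last.
- by move=> z; rewrite mule_ge0 // lee_fin.
- by apply: emeasurable_funM => //; exact: measurableT_comp.
apply: eq_integral => w _; rewrite /fubini_F /=.
have msec : measurable (xsection V w) by exact: measurable_xsection.
under eq_integral => v _.
  rewrite (_ : \1_V (w, v) = \1_(xsection V w) v); last first.
    rewrite !indicE; congr ((nat_of_bool _)%:R); apply/idP/idP => [h|/set_mem //].
    exact: mem_set.
  over.
rewrite ge0_integralZl ?integral_indic ?setIT //.
- by apply/measurable_EFinP; exact: measurable_indic.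
Qed.

Section joint_law.
Context {R : realType} {d : measure_display} {Omega : measurableType d}.
Variable P : probability Omega R.

Lemma ae_eq_measure (A B : set Omega) : measurable A -> measurable B ->
  {ae P, forall w, A w <-> B w} -> P A = P B.
Proof.
move=> mA mB AB.
suff H (C D : set Omega) : measurable C -> measurable D ->
    {ae P, forall w, C w -> D w} -> (P C <= P D)%E.
  by apply/eqP; rewrite eq_le !H //; apply: filterS AB => w [].
move=> mC mD [N [mN N0 CD]].
have -> : P C = (P (C `\` D) + P (C `&` D))%E by exact: measureDI.
have -> : P (C `\` D) = 0%E.
  apply/eqP; rewrite -measure_le0 -N0; apply: le_measure; rewrite ?inE //.
    exact: measurableD.
  by move=> w [Cw Dw]; apply: CD => /= /(_ Cw).
rewrite add0e; apply: le_measure; rewrite ?inE //; first exact: measurableI.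
Qed.

Variables (p m : nat) (pi : 'rV[R]_p) (T : 'I_m -> 'M[R]_p).
Variables (X : 'I_m -> {RV P >-> R}) (J0 : Omega -> 'I_(p + 1)).
Variables (J : 'I_m -> R -> Omega -> 'I_(p + 1)) (S : 'I_m -> R -> 'M[R]_(p + 1)).
Hypothesis hS : forall i, transition_semigroup (full_intensity (T i)) (S i).
Hypothesis J0E : forall i w, J i 0 w = J0 w.
Hypothesis P0 : forall j, P (J0 @^-1` [set lshift 1 j]) = (pi 0 j)%:E.
Hypothesis indJ : cond_independent_processes P J J0.
Hypothesis mJ : forall i (t : R) x, 0 <= t -> measurable (J i t @^-1` [set x]).
Hypothesis XJ : forall i (t : R), 0 <= t ->
  {ae P, forall w, X i w <= t <-> J i t w = absorbing p}.
Hypothesis transJ : forall i (t : R) j, 0 <= t ->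
  (0 < P (J0 @^-1` [set lshift 1 j]))%E ->
  cond_prob P (J i t @^-1` [set absorbing p]) (J0 @^-1` [set lshift 1 j])
  = absorb_cdf (S i) j t.

Lemma preimage_J0 i : J0 = J i 0.
Proof. by apply/funext => w; rewrite J0E. Qed.

Lemma joint_absorbed (k l : 'I_m) (kl : k != l) j (s t : R) : 0 <= s -> 0 <= t ->
  P (J k s @^-1` [set absorbing p] `&` J l t @^-1` [set absorbing p] `&`
     J0 @^-1` [set lshift 1 j]) =
  (pi 0 j * absorb_cdf (S k) j s * absorb_cdf (S l) j t)%:E.
Proof.
move=> s0 t0.
have mB : measurable (J0 @^-1` [set lshift 1 j]) by rewrite (preimage_J0 k); exact: mJ.
have mA1 := mJ k (absorbing p) s0; have mA2 := mJ l (absorbing p) t0.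
set A1 := _ @^-1` _ in mA1 *; set A2 := _ @^-1` _ in mA2 *.
set B := _ @^-1` _ in mB *.
have mA12 : measurable (A1 `&` A2) by exact: measurableI.
have mAB : measurable (A1 `&` A2 `&` B) by exact: measurableI.
(* Conditioning is meaningful only when the starting state has positive probability; otherwise both
   sides vanish. *)
have [pj|pj] := eqVneq (pi 0 j) 0.
  rewrite pj !mul0r; apply/eqP; rewrite -measure_le0 -[leRHS]/((0 : R)%:E) -pj -P0.
  by apply: le_measure; rewrite ?inE //; move=> w [].
have PB : (0 < P B)%E by rewrite lt0e P0 eqe pj -P0 measure_ge0.
pose A i := if i == k then A1 else if i == l then A2 else setT.
have sA i : sigma_process (J i) (A i).
  rewrite /A; case: eqVneq => [->|_].
    by apply: sub_sigma_algebra; exists s, (absorbing p).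
  case: eqVneq => [->|_]; first by apply: sub_sigma_algebra; exists t, (absorbing p).
  by rewrite -setC0; apply: sigma_algebraC; exact: sigma_algebra0.
have capA : \bigcap_(i in [set: 'I_m]) A i = A1 `&` A2.
  apply/seteqP; split => w.
    move=> Aw; split; first by have := Aw k I; rewrite /A eqxx.
    by have := Aw l I; rewrite /A eqxx eq_sym (negbTE kl).
  by move=> [w1 w2] i _; rewrite /A; case: eqVneq => // _; case: eqVneq.
have := indJ PB sA; rewrite capA (bigD1 k) //= (bigD1 l) 1?eq_sym //= big1 => [|i].
  rewrite mulr1 /A eqxx [l == k]eq_sym (negbTE kl) eqxx !transJ //.
  rewrite /cond_prob P0 /= -mulrA => /(canRL (mulfVK pj)) E.
  by rewrite mulrC -E fineK // fin_num_measure.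
move=> /andP[ik il]; rewrite /A (negbTE ik) (negbTE il) /cond_prob setTI.
by rewrite P0 /= divff.
Qed.

Lemma joint_rays (k l : 'I_m) (kl : k != l) j (s t : R) :
  P (X k @^-1` `]-oo, s] `&` X l @^-1` `]-oo, t] `&` J0 @^-1` [set lshift 1 j]) =
  (pi 0 j * absorb_cdf (S k) j s * absorb_cdf (S l) j t)%:E.
Proof.
have mB : measurable (J0 @^-1` [set lshift 1 j]) by rewrite (preimage_J0 k); exact: mJ.
have mX i (u : R) : measurable (X i @^-1` `]-oo, u]).
  exact: measurable_funPTI.
have mXX : measurable (X k @^-1` `]-oo, s] `&` X l @^-1` `]-oo, t] `&` J0 @^-1` [set lshift 1 j]).
  by apply: measurableI => //; exact: measurableI.
(* A start in a transient state rules out [X i <= 0] almost surely, which settles the rays with a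
   negative endpoint. *)
have neg i (u : R) : u < 0 ->
    {ae P, forall w, ~ (X i w <= u /\ J0 w = lshift 1 j)}.
  move=> u0; have := XJ i (lexx 0); apply: filterS => w [H _] [Xu J0w].
  have := H (le_trans Xu (ltW u0)); rewrite J0E J0w => /eqP.
  by rewrite eq_lrshift.
have [s0|s0] := ltP s 0.
  rewrite (absorb_cdf_le0 (hS k) j (ltW s0)) mulr0 mul0r -[RHS](measure0 P).
  apply: ae_eq_measure => //; apply: filterS (neg k s s0) => w /= h.
  by split => //; rewrite in_itv /= => -[[? _] ?]; apply: h.
have [t0|t0] := ltP t 0.
  rewrite (absorb_cdf_le0 (hS l) j (ltW t0)) mulr0 -[RHS](measure0 P).
  apply: ae_eq_measure => //; apply: filterS (neg l t t0) => w /= h.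
  by split => //; rewrite !in_itv /= => -[[_ ?] ?]; apply: h.
rewrite -joint_absorbed //; apply: ae_eq_measure => //.
  by apply: measurableI => //; apply: measurableI; exact: mJ.
apply: filterS2 (XJ k s0) (XJ l t0) => w /= h1 h2; rewrite !in_itv /=; tauto.
Qed.

Hypothesis hpi : probability_row pi.
Variable mu : 'I_m -> 'I_p -> {finite_measure set R -> \bar R}.
Hypothesis muc : forall i j (x : R),
  mu i j `]-oo, x]%classic = (absorb_cdf (S i) j x)%:E.

Let measurable_J0 (k : 'I_m) x : measurable (J0 @^-1` [set x]).
Proof. by rewrite (preimage_J0 k); exact: mJ. Qed.

Let measurable_X i (A : set R) : measurable A -> measurable (X i @^-1` A).
Proof. by move=> mA; exact: measurable_funPTI. Qed.

(** [measure_eq_rays] is applied one coordinate at a time: first in [A] with a ray for [X l], then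
    in [B] with [A] fixed. *)
Lemma joint_rects (k l : 'I_m) (kl : k != l) j A B :
  measurable A -> measurable B ->
  P (X k @^-1` A `&` X l @^-1` B `&` J0 @^-1` [set lshift 1 j]) =
  ((pi 0 j)%:E * (mu k j A * mu l j B))%E.
Proof.
move=> mA mB; set E := J0 @^-1` _; have mE : measurable E by exact: measurable_J0.
have Pfin (C : set Omega) : measurable C -> (P C < +oo)%E.
  by move=> mC; rewrite ltey_eq fin_num_measure.
have step1 (t : R) : P (X k @^-1` A `&` (X l @^-1` `]-oo, t] `&` E)) =
    ((pi 0 j * absorb_cdf (S l) j t)%:E * mu k j A)%E.
  have mF : measurable (X l @^-1` `]-oo, t] `&` E).
    by apply: measurableI => //; exact: measurable_X.
  have c0 : 0 <= pi 0 j * absorb_cdf (S l) j t.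
    by rewrite mulr_ge0 ?(absorb_cdf_ge0 (hS l)) //; case: hpi.
  have mXk : measurable_fun setT (X k) by [].
  have := @measure_eq_rays R (push_measure (mrestr P mF) mXk)
    (mscale (NngNum c0) (mu k j)) _ _ A mA.
  rewrite /= /pushforward /mrestr /mscale /=; apply.
    by rewrite preimage_setT setTI Pfin.
  move=> x; rewrite muc -EFinM setIA joint_rays // mulrAC.
  by congr (_%:E); ring.
have mF : measurable (X k @^-1` A `&` E).
  by apply: measurableI => //; exact: measurable_X.
have c0 : 0 <= pi 0 j * fine (mu k j A).
  by rewrite mulr_ge0 ?fine_ge0 //; case: hpi.
have mXl : measurable_fun setT (X l) by [].
have := @measure_eq_rays R (push_measure (mrestr P mF) mXl)
  (mscale (NngNum c0) (mu l j)) _ _ B mB.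
rewrite /= /pushforward /mrestr /mscale /= EFinM fineK ?fin_num_measure //.
rewrite -muleA => <-.
- by congr (P _); rewrite setIA [X in X `&` _]setIC.
- by rewrite preimage_setT setTI Pfin.
move=> x; rewrite setIA [X in X `&` _]setIC -setIA step1 muc EFinM.
by rewrite -!muleA; congr (_ * _)%E; rewrite muleC.
Qed.

Lemma joint_law_rects (k l : 'I_m) (kl : k != l) A B :
  measurable A -> measurable B ->
  P (X k @^-1` A `&` X l @^-1` B) =
  (\sum_j (pi 0 j)%:E * (mu k j A * mu l j B))%E.
Proof.
move=> mA mB; set C := _ `&` _.
have mC : measurable C by apply: measurableI; exact: measurable_X.
have split_J0 (D : set Omega) : measurable D ->
    P D = (\sum_x P (D `&` J0 @^-1` [set x]))%E.
  move=> mD; rewrite -measure_bigsetU_ord //.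
  - congr (P _); apply/seteqP; split => [w Dw|].
      by rewrite (bigD1 (J0 w)) //=; left.
    apply: (big_ind (fun E => E `<=` D)) => [|U V UD VD w []|x _ w []//].
    - by [].
    - exact: UD.
    - exact: VD.
  - by move=> x; apply: measurableI => //; exact: (measurable_J0 k).
  - apply/trivIsetP => x y _ _ xy; apply/seteqP; split => // w [[_ Jx] [_ Jy]].
    by move: xy; rewrite -Jx -Jy eqxx.
have sumS (F : _ -> \bar R) :
    (\sum_x F x = \sum_i F (lshift 1 i) + F (absorbing p))%E by exact: sum_states.
(* The masses [pi 0 j] of the transient starts already sum to 1. *)
have Pabs : P (J0 @^-1` [set absorbing p]) = 0%E.
  have := split_J0 _ (@measurableT _ Omega); rewrite probability_setT sumS.
  under eq_bigr => j _ do rewrite setTI P0.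
  rewrite setTI sumEFin; have [_ ->] := hpi.
  have := fin_num_measure P _ (measurable_J0 k (absorbing p)).
  by case: (P _) => [r| |] // _ [] r0; congr (_%:E); lra.
rewrite split_J0 // sumS [X in (_ + X)%E](_ : _ = 0%E) ?adde0.
  by apply: eq_bigr => j _; exact: joint_rects.
apply/eqP; rewrite -measure_le0 -Pabs; apply: le_measure; rewrite ?inE //.
  by apply: measurableI => //; exact: (measurable_J0 k).
exact: (measurable_J0 k).
Qed.

(** The law of the pair agrees on rectangles with the [pi]-mixture of the products
    [mu k j \x mu l j], hence everywhere. *)
Lemma joint_expectation (k l : 'I_m) (kl : k != l) (f g : R -> \bar R) :
  measurable_fun setT f -> measurable_fun setT g ->
  (forall x, 0 <= f x)%E -> (forall x, 0 <= g x)%E ->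
  (\int[P]_w (f (X k w) * g (X l w)) =
   \sum_j (pi 0 j)%:E * ((\int[mu k j]_x f x) * (\int[mu l j]_x g x)))%E.
Proof.
move=> mf mg f0 g0.
have mXX : measurable_fun setT (fun w => (X k w, X l w)) by exact: measurable_fun_pair.
have pi0 j : 0 <= pi 0 j by case: hpi.
pose nu j : {measure set (R * R) -> \bar R} := (mu k j \x mu l j)%E.
pose a j := NngNum (pi0 j).
have lawE D : measurable D -> push_measure P mXX D = weighted_measure a nu D.
  apply: eq_measure_rect => [|A B mA mB].
    by rewrite /= /pushforward preimage_setT probability_setT ltry.
  rewrite weighted_measureE /= /pushforward.
  under eq_bigr => j _ do rewrite product_measure1E //.
  exact: joint_law_rects.
have mfg : measurable_fun setT (fun z : R * R => (f z.1 * g z.2)%E).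
  apply: emeasurable_funM; first exact: measurableT_comp.
  exact: measurableT_comp.
have fg0 (z : R * R) : (0 <= f z.1 * g z.2)%E by rewrite mule_ge0.
transitivity (\int[push_measure P mXX]_z (f z.1 * g z.2))%E.
  by rewrite (ge0_integral_pushforward mXX).
rewrite (@integral_weighted _ _ _ _ a nu) //.
  by apply: eq_bigr => j _; rewrite integral_product_mul.
by move=> D mD _; rewrite lawE // weighted_measureE.
Qed.

Hypothesis mu1 : forall i j, (mu i j setT <= 1)%E.

(** On the full rectangle [joint_rects] reads [pi_j = pi_j a b] with [a, b <= 1], forcing
    [a = b = 1]. Almost sure absorption thus comes from [X] being real-valued. *)
Lemma absorb_mass (k l : 'I_m) (kl : k != l) j : pi 0 j != 0 -> mu k j setT = 1%E.
Proof.
move=> pj.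
have := joint_rects kl j (@measurableT _ R) (@measurableT _ R).
rewrite !preimage_setT !setTI P0.
have := mu1 k j; have := mu1 l j.
have := fine_ge0 (measure_ge0 (mu k j) setT).
have := fine_ge0 (measure_ge0 (mu l j) setT).
rewrite -[mu k j setT]fineK ?fin_num_measure // -[mu l j setT]fineK ?fin_num_measure //.
move: (fine (mu k j setT)) (fine (mu l j setT)) => a b.
rewrite -!EFinM !lee_fin => b0 a0 b1 a1 [] /eqP.
rewrite -subr_eq0 -{1}[pi 0 j]mulr1 -mulrBr mulf_eq0 (negbTE pj) subr_eq0 /= => /eqP ab.
congr (_%:E); apply/le_anti; rewrite a1 /=; nra.
Qed.

(** The survival function of [X i], by [prob_gt]. *)
Definition mixture_surv i (x : R) : R := \sum_j pi 0 j * (1 - absorb_cdf (S i) j x).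

Lemma mixture_surv_compl i x :
  1 - mixture_surv i x = \sum_j pi 0 j * absorb_cdf (S i) j x.
Proof.
have [_ <-] := hpi; rewrite /mixture_surv -sumrB; apply: eq_bigr => j _; ring.
Qed.

Lemma prob_le (k l : 'I_m) (kl : k != l) (x : R) :
  P [set w | X k w <= x] = (1 - mixture_surv k x)%:E.
Proof.
have lk : l != k by rewrite eq_sym.
have mray : measurable (`]-oo, x]%classic : set R) by exact: measurable_itv.
have := joint_law_rects kl mray (@measurableT _ R).
rewrite preimage_setT setIT (_ : X k @^-1` _ = [set w | X k w <= x]); last first.
  by apply/seteqP; split => w /=; rewrite in_itv.
move=> ->; rewrite mixture_surv_compl -sumEFin; apply: eq_bigr => j _.
have [->|pj] := eqVneq (pi 0 j) 0; first by rewrite mul0e mul0r.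
by rewrite muc (absorb_mass lk) // mule1.
Qed.

Lemma prob_gt (k l : 'I_m) (kl : k != l) (x : R) :
  P [set w | x < X k w] = (mixture_surv k x)%:E.
Proof.
rewrite (_ : [set w | _] = ~` [set w | X k w <= x]); last first.
  by apply/seteqP; split => w /=; rewrite ltNge => /negP.
rewrite probability_setC ?(prob_le kl) -?EFinB; first by congr (_%:E); ring.
rewrite (_ : [set w | _] = X k @^-1` `]-oo, x]); first exact: measurable_X.
by apply/seteqP; split => w /=; rewrite in_itv.
Qed.

(** There are no atoms: by the uniform modulus, [P (X k <= x)] exceeds [P (X k <= x - h)] by at most
    [e] for a suitable [h > 0]. *)
Lemma prob_lt (k l : 'I_m) (kl : k != l) (x : R) :
  P [set w | X k w < x] = (1 - mixture_surv k x)%:E.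
Proof.
have mle (y : R) : measurable [set w | X k w <= y].
  rewrite (_ : [set w | _] = X k @^-1` `]-oo, y]); first exact: measurable_X.
  by apply/seteqP; split => w /=; rewrite in_itv.
have mlt : measurable [set w | X k w < x].
  rewrite (_ : [set w | _] = X k @^-1` `]-oo, x[); first exact: measurable_X.
  by apply/seteqP; split => w /=; rewrite in_itv.
apply/eqP; rewrite eq_le -{1}(prob_le kl) le_measure ?inE //=; last first.
  by move=> w /= /ltW.
apply/lee_addgt0Pr => e e0.
have [h [h0 hc]] : exists h, 0 < h /\ forall j t,
    absorb_cdf (S k) j (t + h) - absorb_cdf (S k) j t <= e.
  have /at_right_itv[r r0 Hr] := absorb_cdf_modulus (hS k) e0.
  exists (r / 2); split; first by rewrite divr_gt0.
  by apply: Hr; apply/andP; split; lra.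
apply: (@le_trans _ _ (P [set w | (X k w <= x - h)%R] + e%:E)%E).
  rewrite (prob_le kl) -EFinD lee_fin !mixture_surv_compl -lerBlDl -sumrB.
  have [pi0 pi1] := hpi; rewrite -[e]mul1r -pi1 mulr_suml; apply: ler_sum => j _.
  by rewrite -mulrBr ler_wpM2l // -{1}[x](subrK h).
rewrite leeD2r // le_measure ?inE //.
by move=> w /= Xw; apply: le_lt_trans Xw _; rewrite ltrBlDr ltrDl.
Qed.

Lemma mixture_surv_ge0 i x : 0 <= mixture_surv i x.
Proof.
have [pi0 _] := hpi; rewrite sumr_ge0 // => j _; rewrite mulr_ge0 //.
by rewrite subr_ge0 (absorb_cdf_le1 (hS i)).
Qed.

Lemma mixture_surv_le1 i x : mixture_surv i x <= 1.
Proof.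
rewrite -subr_ge0 mixture_surv_compl; have [pi0 _] := hpi.
by rewrite sumr_ge0 // => j _; rewrite mulr_ge0 // (absorb_cdf_ge0 (hS i)).
Qed.

Lemma measurable_mixture_surv i (A : set R) : measurable_fun A (mixture_surv i).
Proof.
apply: measurable_sum => j; apply: measurable_funM; first exact: measurable_cst.
apply: measurable_funB; first exact: measurable_cst.
by apply: measurable_funTS; exact: (measurable_absorb_cdf (hS i)).
Qed.

Lemma integral_mixture_surv k j :
  (\int[mu k j]_x (mixture_surv k x)%:E =
   (\sum_i pi 0 i * absorb_order_mx (S k) (mu k) i j)%:E)%E.
Proof.
have [pi0 _] := hpi.
have msurv i D := measurable_absorb_surv (hS k) i D.
have surv0 i x := absorb_surv_ge0 (hS k) i x.
pose N : set R := `]-oo, 0]%classic; pose D : set R := `]0, +oo[%classic.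
have mN : measurable N by exact: measurable_itv.
have mD : measurable D by exact: measurable_itv.
have mg (A : set R) : measurable_fun A (fun x => (mixture_surv k x)%:E).
  by apply/measurable_EFinP; exact: measurable_mixture_surv.
have g0 x : (0 <= (mixture_surv k x)%:E)%E by rewrite lee_fin mixture_surv_ge0.
have ND : [set: R] = N `|` D.
  apply/seteqP; split => // x _; rewrite /N /D /= !in_itv /= andbT.
  by case: (leP x 0); [left|right].
have muN : mu k j N = 0%E by rewrite /N muc (absorb_cdf_le0 (hS k)).
rewrite ND ge0_integral_setU //; first last.
- rewrite disj_set2E; apply/eqP/seteqP; split => // x [].
  by rewrite /N /D /= !in_itv /= andbT leNgt => /negP.
rewrite null_set_integral //.
rewrite add0e.
under eq_integral => x _ do rewrite -sumEFin.
rewrite ge0_integral_sum //; first last.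
- by move=> i x _; rewrite EFinM mule_ge0 // lee_fin.
- by move=> i; rewrite /=; under eq_fun do rewrite EFinM; apply: measurable_funeM; exact: msurv.
rewrite -sumEFin; apply: eq_bigr => i _.
under eq_integral => x _ do rewrite EFinM.
rewrite ge0_integralZl ?lee_fin //; last exact: msurv.
by rewrite (absorb_order_mxE (hS k) (mu1 k)) // EFinM.
Qed.

(** The [B_{ij}] of the overview: [a] is the start of the independent copy, [j] that of [X i]. *)
Definition mixture_order i j : R := \sum_a pi 0 a * absorb_order_mx (S i) (mu i) a j.

Lemma integral_mixture_cdf (k l : 'I_m) (kl : k != l) j : pi 0 j != 0 ->
  (\int[mu k j]_x (1 - mixture_surv k x)%:E = (1 - mixture_order k j)%:E)%E.
Proof.
move=> pj; have mg := @measurable_mixture_surv k setT.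
have : (\int[mu k j]_x ((1 - mixture_surv k x)%:E + (mixture_surv k x)%:E) = 1)%E.
  under eq_integral => x _ do rewrite -EFinD subrK.
  by rewrite integral_cst // mul1e; exact: absorb_mass kl _ pj.
rewrite ge0_integralD //.
- rewrite integral_mixture_surv => /esym/eqP; rewrite -sube_eq ?fin_num_adde_defl // => /eqP <-.
  by rewrite -EFinB.
- by move=> x _; rewrite lee_fin subr_ge0 mixture_surv_le1.
- by apply/measurable_EFinP; apply: measurable_funB; [exact: measurable_cst|exact: mg].
- by move=> x _; rewrite lee_fin mixture_surv_ge0.
- by apply/measurable_EFinP; exact: mg.
Qed.

(** The boolean encodes the strict sign of [X i z.1 - X i z.2], with [true] for positive.
    [order_fun] is the matching probability given the value of [X i z.1], and [order_prob] its mean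
    given the start [j]. *)
Definition order_set (b : bool) (i : 'I_m) : set (Omega * Omega) :=
  [set z | if b then X i z.2 < X i z.1 else X i z.1 < X i z.2].

Definition order_fun (b : bool) i (x : R) : R :=
  if b then 1 - mixture_surv i x else mixture_surv i x.

Definition order_prob (b : bool) i j : R :=
  if b then 1 - mixture_order i j else mixture_order i j.

Lemma measurable_order_set b i : measurable (order_set b i).
Proof.
have mX1 : measurable_fun setT (fun z : Omega * Omega => X i z.1).
  exact: measurableT_comp.
have mX2 : measurable_fun setT (fun z : Omega * Omega => X i z.2).
  exact: measurableT_comp.
have mlt (f g : Omega * Omega -> R) : measurable_fun setT f ->
    measurable_fun setT g -> measurable [set z | f z < g z].
  move=> mf mg.
  have -> : [set z | f z < g z] = setT `&` (fun z => f z < g z) @^-1` [set true].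
    by rewrite setTI.
  exact: measurable_fun_ltr.
by rewrite /order_set; case: b; exact: mlt.
Qed.

Lemma prob_order_section (k l : 'I_m) (kl : k != l) b w :
  P (xsection (order_set b k) w) = (order_fun b k (X k w))%:E.
Proof.
rewrite /order_fun; case: b; rewrite -(prob_lt kl, prob_gt kl);
  by congr (P _); apply/seteqP; split => v; rewrite /xsection /= inE.
Qed.

Lemma integral_order_fun (k l : 'I_m) (kl : k != l) b j : pi 0 j != 0 ->
  (\int[mu k j]_x (order_fun b k x)%:E = (order_prob b k j)%:E)%E.
Proof.
move=> pj; rewrite /order_fun /order_prob; case: b.
  exact: integral_mixture_cdf kl _ pj.
exact: integral_mixture_surv.
Qed.

(** Fixing the first copy makes the two comparisons independent; the product of their section
    probabilities is then averaged over that copy by [joint_expectation]. *)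
Lemma prob_quadrant (k l : 'I_m) (kl : k != l) b c :
  ((P \x P) \x P)%E
    [set w | order_set b k (w.1.1, w.2) /\ order_set c l (w.1.1, w.1.2)] =
  (\sum_j pi 0 j * order_prob b k j * order_prob c l j)%:E.
Proof.
have lk : l != k by rewrite eq_sym.
have order_fun0 a i x : (0 <= (order_fun a i x)%:E)%E.
  by rewrite lee_fin /order_fun; case: a; rewrite ?subr_ge0 ?mixture_surv_le1 ?mixture_surv_ge0.
have order_funM a i : measurable_fun setT (fun x => (order_fun a i x)%:E).
  apply/measurable_EFinP; have mg := @measurable_mixture_surv i setT.
  rewrite /order_fun; case: a => //; apply: measurable_funB => //.
rewrite product_measure3_sections; try exact: measurable_order_set.
under eq_integral => w _ do
  rewrite (prob_order_section kl) (prob_order_section lk).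
rewrite (joint_expectation kl (f := fun x => (order_fun b k x)%:E)
  (g := fun x => (order_fun c l x)%:E)) //.
rewrite -sumEFin; apply: eq_bigr => j _.
have [->|pj] := eqVneq (pi 0 j) 0; first by rewrite mul0e !mul0r.
by rewrite (integral_order_fun kl) // (integral_order_fun lk) // -!EFinM mulrA.
Qed.

(** The double sum equals its transpose, and [M + M^T] is the all-ones matrix; twice the sum is
    therefore [(sum pi)^2 = 1]. *)
Lemma mixture_order_half i : transient_subintensity (T i) ->
  \sum_j pi 0 j * mixture_order i j = 2^-1.
Proof.
move=> tT; pose M := absorb_order_mx (S i) (mu i).
have TM : exit_lyapunov (T i) M.
  exact: (absorb_order_lyapunov (hS i) (mu1 i) (muc i)).
have sym a b : M a b + M b a = 1 by exact: exit_lyapunov_sym tT TM.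
have [_ pi1] := hpi.
suff : \sum_j pi 0 j * mixture_order i j + \sum_j pi 0 j * mixture_order i j = 1.
  by move=> h; lra.
have E : \sum_j pi 0 j * mixture_order i j = \sum_j \sum_a pi 0 j * pi 0 a * M a j.
  by apply: eq_bigr => j _; rewrite mulr_sumr; apply: eq_bigr => a _; rewrite mulrA.
rewrite E {1}exchange_big /= -big_split /= -[RHS]mulr1 -{1}pi1 -pi1 mulr_suml.
apply: eq_bigr => j _; rewrite -big_split /= mulr_sumr; apply: eq_bigr => a _.
by rewrite [pi 0 a * _]mulrC -mulrDr sym mulr1.
Qed.

Lemma spearman_order (k l : 'I_m) (kl : k != l) :
  transient_subintensity (T k) -> transient_subintensity (T l) ->
  spearman (X k) (X l) =
  12 * (\sum_j pi 0 j * (1 - mixture_order k j) * (1 - mixture_order l j)) - 3.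
Proof.
move=> tk tl; rewrite /spearman.
pose Q b c : set (Omega * Omega * Omega) :=
  [set w | order_set b k (w.1.1, w.2) /\ order_set c l (w.1.1, w.1.2)].
pose P3 : {measure set (Omega * Omega * Omega) -> \bar R} := ((P \x P) \x P)%E.
pose q b c : R := \sum_j pi 0 j * order_prob b k j * order_prob c l j.
have P3Q b c : P3 (Q b c) = (q b c)%:E by exact: prob_quadrant.
have mf : measurable_fun setT (fun w : Omega * Omega * Omega => (w.1.1, w.2)).
  by apply: measurable_fun_pair => //; exact: measurableT_comp.
have mQ b c : measurable (Q b c).
  apply: measurableI.
    by rewrite -[X in measurable X]setTI; apply: mf => //; exact: measurable_order_set.
  have mg : measurable_fun setT (fun w : Omega * Omega * Omega => (w.1.1, w.1.2)).
    by apply: measurable_fun_pair; exact: measurableT_comp.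
  by rewrite -[X in measurable X]setTI; apply: mg => //; exact: measurable_order_set.
have P3U b c : fine (P3 (Q b c `|` Q (~~ b) (~~ c))) = q b c + q (~~ b) (~~ c).
  have -> : P3 (Q b c `|` Q (~~ b) (~~ c)) = (P3 (Q b c) + P3 (Q (~~ b) (~~ c)))%E.
    apply: measureU => //; apply/seteqP; split => // w [[+ _] [+ _]].
    by rewrite /order_set /=; case: b => /= /lt_trans /[apply]; rewrite ltxx.
  by rewrite !P3Q.
(* A nonzero product excludes ties, so each event is a union of two open quadrants. *)
rewrite (_ : [set w | 0 < _] = Q true true `|` Q false false); last first.
  apply/seteqP; split => w; rewrite /Q /order_set /=.
    case: (ltgtP (X k w.2) (X k w.1.1)) => h1;
    case: (ltgtP (X l w.1.2) (X l w.1.1)) => h2 h;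
    by [left|right|exfalso; nra].
  by case=> -[h1 h2]; nra.
rewrite (_ : [set w | _ < 0] = Q true false `|` Q false true); last first.
  apply/seteqP; split => w; rewrite /Q /order_set /=.
    case: (ltgtP (X k w.2) (X k w.1.1)) => h1;
    case: (ltgtP (X l w.1.2) (X l w.1.1)) => h2 h;
    by [left|right|exfalso; nra].
  by case=> -[h1 h2]; nra.
rewrite -/P3 (P3U true true) (P3U true false) /=.
have [_ pi1] := hpi.
have hk := mixture_order_half tk; have hl := mixture_order_half tl.
set s := \sum_j _ * _.
have E1 : q true true = s by [].
(* Expanding [B_k B_l] around [(1 - B_k) (1 - B_l)] and using both means [1/2] expresses every
   quadrant through [s]; the total is [3 (2 s - (1 - 2 s)) = 12 s - 3]. *)
have E2 : q false false = s.
  transitivity (s - \sum_j pi 0 j + \sum_j pi 0 j * mixture_order k j +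
      \sum_j pi 0 j * mixture_order l j); last by rewrite pi1 hk hl; lra.
  rewrite /q /s -sumrB -!big_split /=; apply: eq_bigr => j _; ring.
have E3 : q true false = 2^-1 - s.
  transitivity (\sum_j pi 0 j - \sum_j pi 0 j * mixture_order k j - s);
    last by rewrite pi1 hk; lra.
  rewrite /q /s -!sumrB; apply: eq_bigr => j _ /=; ring.
have E4 : q false true = 2^-1 - s.
  transitivity (\sum_j pi 0 j - \sum_j pi 0 j * mixture_order l j - s);
    last by rewrite pi1 hl; lra.
  rewrite /q /s -!sumrB; apply: eq_bigr => j _ /=; ring.
rewrite E1 E2 E3 E4; lra.
Qed.

End joint_law.

Unset Implicit Arguments.

Theorem theorem2p9 (R : realType) (disp : measure_display)
    (Omega : measurableType disp) (P : probability Omega R)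
    (d p : nat) (pi : 'rV[R]_p) (T : 'I_d -> 'M[R]_p)
    (X : 'I_d -> {RV P >-> R}) (hX : mPH pi T X)
    (k l : 'I_d) (hkl : k != l) :
  let F (i : 'I_d) (j : 'I_p) : R :=
    1 + ((pi *t (basis_col R j)^T) *m invmx (kronsum (T i) (T i))
         *m (ones_col R p *t exit_rates (T i))) 0 0 in
  spearman (X k) (X l) = 12 * (\sum_(j < p) pi 0 j * F k j * F l j) - 3.
Proof.
move=> F; case: hX => hpi tT [J0 [J [hJ J0E P0 indJ aeX]]].
have mJ i (t : R) x : 0 <= t -> measurable (J i t @^-1` [set x]).
  by case: (hJ i) => h _ _ _; exact: h.
(* One semigroup is fixed per index, together with the two consequences of the Markov property that
   the joint law needs. *)
have /choice[S hS] i : exists S, [/\ transition_semigroup (full_intensity (T i)) S,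
    forall t : R, 0 <= t -> {ae P, forall w, X i w <= t <-> J i t w = absorbing p} &
    forall (t : R) j, 0 <= t -> (0 < P (J0 @^-1` [set lshift 1 j]))%E ->
      cond_prob P (J i t @^-1` [set absorbing p]) (J0 @^-1` [set lshift 1 j])
      = absorb_cdf S j t].
  case: (hJ i) => _ rcJ _ [S hS markovJ]; exists S; split => //.
    by move=> t t0; apply: (absorption_time_le hS (mJ i) rcJ markovJ).
  move=> t j t0; rewrite (preimage_J0 J0E i) => Pj.
  by rewrite absorb_cdfE // -(markov_transition markovJ _ (lexx 0) t0 Pj) add0r.
have hS0 i : transition_semigroup (full_intensity (T i)) (S i) by case: (hS i).
have /choice[mu hmu] i : exists mu : 'I_p -> {finite_measure set R -> \bar R},
    forall j, (mu j setT <= 1)%E /\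
      forall x : R, mu j `]-oo, x]%classic = (absorb_cdf (S i) j x)%:E.
  suff /choice[nu hnu] j : exists m : {finite_measure set R -> \bar R},
      (m setT <= 1)%E /\ forall x : R, m `]-oo, x]%classic = (absorb_cdf (S i) j x)%:E.
    by exists nu.
  apply: cumulative_measure.
  - exact: absorb_cdf_homo (hS0 i) j.
  - exact: absorb_cdf_right_continuous (hS0 i) j.
  - exact: absorb_cdf_le0 (hS0 i) j.
  - exact: absorb_cdf_le1 (hS0 i) j.
have muc i j (x : R) : mu i j `]-oo, x]%classic = (absorb_cdf (S i) j x)%:E.
  by case: (hmu i j).
have mu1 i j : (mu i j setT <= 1)%E by case: (hmu i j).
(* The Kronecker expression is [- B_{ij}] by [exit_lyapunov_kron], so [F i j] is the probability of
   the reverse order. *)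
have FE i j : F i j = 1 - mixture_order pi S mu i j.
  rewrite /F (exit_lyapunov_kron _ _ (tT i)
    (absorb_order_lyapunov (hS0 i) (mu1 i) (muc i))) //.
under eq_bigr => j _ do rewrite !FE.
apply: (spearman_order hS0 J0E P0 indJ mJ _ _ hpi muc mu1 hkl (tT k) (tT l)).
- by move=> i t t0; case: (hS i) => _ h _; exact: h.
- by move=> i t j t0; case: (hS i) => _ _ h; exact: h.
Qed.
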